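(* Let $R$ be a supercommutative ring and $A$ a super Azumaya algebra over $R$, and let $A^e = A\otimes_R A^o$. Then the functors $$A\otimes_R - : {}_R\mathfrak{M}\to{}_{A^e}\mathfrak{M},\qquad (-)^A : {}_{A^e}\mathfrak{M}\to{}_R\mathfrak{M}$$ are mutually inverse category equivalences.
   Context: A super ring is an associative unital ring $R=R_0\oplus R_1$ graded by $\mathbb{Z}_2$ with $R_iR_j\subseteq R_{i+j}$; $|x|$ is the parity of a homogeneous element. It is supercommutative if $rr'=(-1)^{|r||r'|}r'r$ for homogeneous $r,r'$. All modules are $\mathbb{Z}_2$-graded with compatible action, and ${}_R\mathfrak{M}$ (resp. ${}_{A^e}\mathfrak{M}$) is the category of left graded modules with parity-preserving homomorphisms. $\underline{Hom}_R$ denotes all module homomorphisms (even part: parity-preserving, odd part: parity-reversing), and $\underline{End}_R(A)=\underline{Hom}_R(A,A)$ is formed with $A$ regarded as a right $R$-module. The supercenter of a super ring $A$ is $Z(A)=\{x\in A: ax=(-1)^{|a||x|}xa \text{ for all homogeneous } a\in A\}$. For $R$ supercommutative, an $R$-superalgebra is a super ring $A$ with a super ring morphism $i:R\to A$ such that $i(R)\subseteq Z(A)$. The opposite $A^o$ has multiplication $x\cdot_o y=(-1)^{|x||y|}y\cdot x$ and is an $R$-superalgebra via the same map $i$. The tensor product of $R$-superalgebras has multiplication $(a\otimes b)(c\otimes d)=(-1)^{|b||c|}ac\otimes bd$, and $A^e:=A\otimes_R A^o$. $A$ is a super Azumaya algebra over $R$ if $A$ is a faithful, finitely generated projective $R$-module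 (projective: the functor of parity-preserving homomorphisms out of it is exact) and the natural morphism $\phi:A^e\to\underline{End}_R(A)$, $\phi(a\otimes b)(x)=(-1)^{|b||x|}axb$, is an isomorphism of $R$-superalgebras. $A$ is a left $A^e$-module via $\phi$, and $A\otimes_R N$ is a left $A^e$-module through the first factor. A left $A^e$-module $M$ is the same as an $(A,A)$-bimodule via $a\cdot m=(a\otimes 1)m$, $m\cdot a=(-1)^{|a||m|}(1\otimes a)m$. $R$ acts on $M$ through $i:R\to A$. The supercommutant $M^A$ is the $(R,R)$-bimodule generated by the (homogeneous) $m\in M$ such that $am=(-1)^{|a||m|}ma$ for all homogeneous $a\in A$, equivalently $(a\otimes1)m=(1\otimes a)m$ for all homogeneous $a\in A$; it is regarded as a left $R$-module. On a morphism $f:M\to N$ of $A^e$-modules, the functor $(-)^A$ is the restriction $f|_{M^A}:M^A\to N^A$. ''Mutually inverse'' means the composites are naturally isomorphic to the identity functors. *)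

(* Defs.v *)
From HB Require Import structures.
From mathcomp Require Import all_boot all_algebra.
From mathcomp Require Import boolp.

Set Implicit Arguments.
Unset Strict Implicit.
Unset Printing Implicit Defensive.

Import GRing.Theory.
Local Open Scope ring_scope.
Local Open Scope quotient_scope.

(* Parities are booleans (true = odd): i (+) j is their sum, i && j their
   product, and sg (i && j) x is (-1)^{ij} x. *)
Definition sg (V : zmodType) (b : bool) (x : V) : V := if b then - x else x.

(* A direct sum decomposition V = V_0 (+) V_1, given by its two component
   projections; V_i is the image of cpt i. *)
HB.mixin Record isZ2Graded V of GRing.Zmodule V := {
  cpt : bool -> V -> V;
  cptD : forall i x y, cpt i (x + y) = cpt i x + cpt i y;
  cpt_sum : forall x, cpt false x + cpt true x = x;
  cptK : forall i j x, cpt i (cpt j x) = if i == j then cpt j x else 0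
}.
#[short(type="gradedZmodType")]
HB.structure Definition GradedZmod :=
  { V of GRing.Zmodule V & isZ2Graded V }.

Definition homog (V : gradedZmodType) (i : bool) (x : V) : Prop := cpt i x = x.

Definition even_map (V W : gradedZmodType) (f : V -> W) : Prop :=
  forall i x, homog i x -> homog i (f x).

HB.mixin Record PzRing_isSuper R of GRing.PzRing R & GradedZmod R := {
  homogM : forall (i j : bool) (x y : R),
    homog i x -> homog j y -> homog (i (+) j) (x * y)
}.
#[short(type="superRingType")]
HB.structure Definition SuperRing :=
  { R of GRing.PzRing R & GradedZmod R & PzRing_isSuper R }.
Arguments homogM {_} [i j x y].

HB.mixin Record Lmodule_isSuper (R : superRingType) V
    of GRing.Lmodule R V & GradedZmod V := {
  homogZ : forall (i j : bool) (r : R) (x : V),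
    homog i r -> homog j x -> homog (i (+) j) (r *: x)
}.
#[short(type="superLmodType")]
HB.structure Definition SuperLmodule (R : superRingType) :=
  { V of GRing.Lmodule R V & GradedZmod V & Lmodule_isSuper R V }.
Arguments homogZ {_ _} [i j r x].

Definition supercommutative (R : superRingType) : Prop :=
  forall i j (x y : R), homog i x -> homog j y -> x * y = sg (i && j) (y * x).

(* For inhomogeneous x the sign rule is imposed on each component. *)
Definition supercenter (A : superRingType) (x : A) : Prop :=
  forall i j a, homog i a -> a * cpt j x = sg (i && j) (cpt j x * a).

Record superAlg (R : superRingType) := SuperAlg {
  salg :> superRingType;
  smap : {rmorphism R -> salg};
  smap_even : even_map smap;
  smap_central : forall r, supercenter (smap r)
}.
Arguments smap {R} s.
Arguments smap_even {R s} [i x].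
Arguments smap_central {R} s.

Section SignTheory.
Variable V : zmodType.
Implicit Types x y : V.
Lemma sgD b x y : sg b (x + y) = sg b x + sg b y.
Proof. by case: b; rewrite /sg ?opprD. Qed.

Lemma sg0 b : sg b 0 = 0 :> V.
Proof. by case: b; rewrite /sg ?oppr0. Qed.

Lemma sgC b c x : sg b (sg c x) = sg (b (+) c) x.
Proof. by case: b; case: c; rewrite /sg /= ?opprK. Qed.

End SignTheory.

Lemma hom0 (V W : zmodType) (f : V -> W) : {morph f : a b / a + b} -> f 0 = 0.
Proof. by move=> fD; apply: (addrI (f 0)); rewrite -fD !addr0. Qed.

Lemma hom_sg (V W : zmodType) (f : V -> W) b x :
  {morph f : a b / a + b} -> f (sg b x) = sg b (f x).
Proof.
move=> fD; case: b => //; rewrite /sg.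
by apply: (addrI (f x)); rewrite -fD !subrr (hom0 fD).
Qed.

Lemma sgK (V : zmodType) b (x : V) : sg b (sg b x) = x.
Proof. by rewrite sgC addbb. Qed.

Section GradedTheory.
Variable V : gradedZmodType.
Implicit Types (x y : V) (i j : bool).

Lemma cpt0 i : cpt i 0 = 0 :> V.
Proof. by apply: (addrI (cpt i 0)); rewrite -cptD !addr0. Qed.

Lemma cptN i x : cpt i (- x) = - cpt i x.
Proof. by apply: (addrI (cpt i x)); rewrite -cptD !subrr cpt0. Qed.

Lemma cpt_sg i b x : cpt i (sg b x) = sg b (cpt i x).
Proof. by case: b; rewrite /sg ?cptN. Qed.

Lemma homog_cpt i x : homog i (cpt i x).
Proof. by rewrite /homog cptK eqxx. Qed.

Lemma cpt_homog i j x : homog j x -> cpt i x = if i == j then x else 0.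
Proof. by move=> <-; rewrite cptK. Qed.

Lemma homogD i x y : homog i x -> homog i y -> homog i (x + y).
Proof. by rewrite /homog cptD => -> ->. Qed.

Lemma homog0 i : homog i (0 : V).
Proof. exact: cpt0. Qed.

Lemma homogN i x : homog i x -> homog i (- x).
Proof. by rewrite /homog cptN => ->. Qed.

Lemma homog_sg i b x : homog i x -> homog i (sg b x).
Proof. by rewrite /homog cpt_sg => ->. Qed.

Lemma homog_ind (P : V -> Prop) :
  (forall i x, homog i x -> P x) ->
  (forall x y, P x -> P y -> P (x + y)) -> forall x, P x.
Proof.
move=> Ph PD x; rewrite -[x]cpt_sum.
by apply: (PD); apply: Ph; apply: homog_cpt.
Qed.

End GradedTheory.

Lemma even_cpt (V W : gradedZmodType) (f : V -> W) i x :
  {morph f : a b / a + b} -> even_map f -> f (cpt i x) = cpt i (f x).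
Proof.
move=> fD fe; have f0 : f 0 = 0 by apply: (addrI (f 0)); rewrite -fD !addr0.
elim/homog_ind: x => [j x hx|x y IHx IHy]; last by rewrite !(cptD, fD) IHx IHy.
rewrite (cpt_homog _ hx) (cpt_homog _ (fe _ _ hx)).
by case: (i == j).
Qed.

Lemma sgMl (R : pzRingType) b (x y : R) : sg b x * y = sg b (x * y).
Proof. by case: b; rewrite /sg ?mulNr. Qed.

Lemma sgMr (R : pzRingType) b (x y : R) : x * sg b y = sg b (x * y).
Proof. by case: b; rewrite /sg ?mulrN. Qed.

Lemma homog1 (R : superRingType) : homog false (1 : R).
Proof.
pose e := cpt true (1 : R); pose o := cpt false (1 : R).
have he : homog true e := homog_cpt _ _; have ho : homog false o := homog_cpt _ _.
have oe1 : o + e = 1 := cpt_sum 1.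
have oe : o * e = e.
  have : cpt true (1 * e) = e by rewrite mul1r.
  rewrite -oe1 mulrDl cptD (homogM ho he : cpt true _ = _).
  by rewrite (cpt_homog true (homogM he he)) addr0.
have e0 : e = 0.
  have : cpt true (o * 1) = 0 by rewrite mulr1 cptK.
  rewrite -oe1 mulrDr cptD (homogM ho he : cpt true _ = _) oe.
  by rewrite (cpt_homog true (homogM ho ho)) add0r.
by rewrite /homog -[RHS]oe1 e0 addr0.
Qed.

(* The biadditive extension of (x, y) |-> (-1)^{|x||y|} F x y from homogeneous
   to arbitrary arguments; see ksumE. *)
Definition ksum (V W : gradedZmodType) (Z : zmodType) (F : V -> W -> Z)
    (x : V) (y : W) : Z :=
  \sum_(i : bool) \sum_(j : bool) sg (i && j) (F (cpt i x) (cpt j y)).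

Section Ksum.
Variables (V W : gradedZmodType) (Z : zmodType).
Implicit Types (F G : V -> W -> Z).

Definition biadditive F : Prop :=
  (forall y, {morph F^~ y : a b / a + b}) /\ (forall x, {morph F x : a b / a + b}).

Lemma ksumE F i j x y : biadditive F -> homog i x -> homog j y ->
  ksum F x y = sg (i && j) (F x y).
Proof.
move=> [Fl Fr] hx hy.
have F0l w : F 0 w = 0 by apply: (addrI (F 0 w)); rewrite -[LHS]Fl !addr0.
have F0r v : F v 0 = 0 by apply: (addrI (F v 0)); rewrite -Fr !addr0.
rewrite /ksum !big_bool /= !(cpt_homog _ hx) !(cpt_homog _ hy).
by case: i {hx}; case: j {hy}; rewrite /= ?(F0l, F0r) /sg ?oppr0 ?addr0 ?add0r.
Qed.

Lemma ksumDl F y : biadditive F -> {morph (ksum F)^~ y : a b / a + b}.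
Proof.
move=> [Fl Fr] a b; rewrite /ksum -big_split; apply: eq_bigr => i _ /=.
rewrite -big_split; apply: eq_bigr => j _ /=.
by rewrite cptD -sgD [F (_ + _) _]Fl.
Qed.

Lemma ksumDr F x : biadditive F -> {morph ksum F x : a b / a + b}.
Proof.
move=> [Fl Fr] a b; rewrite /ksum -big_split; apply: eq_bigr => i _ /=.
rewrite -big_split; apply: eq_bigr => j _ /=.
by rewrite cptD -sgD Fr.
Qed.

Lemma ksumDf F G H x y : (forall v w, H v w = F v w + G v w) ->
  ksum H x y = ksum F x y + ksum G x y.
Proof.
move=> e; rewrite /ksum -big_split; apply: eq_bigr => i _ /=.
by rewrite -big_split; apply: eq_bigr => j _ /=; rewrite e sgD.
Qed.
End Ksum.

Section SuperAlgTheory.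
Variables (R : superRingType) (A : superAlg R).

Lemma smap_comm i j (r : R) (a : A) : homog i r -> homog j a ->
  a * smap A r = sg (i && j) (smap A r * a).
Proof.
move=> hr ha; have := smap_central A r j i a ha.
by rewrite (smap_even hr : cpt i _ = _) andbC.
Qed.

End SuperAlgTheory.

(* The left R-module underlying A, with r . a = i(r) a. *)
Definition asmod (R : superRingType) (A : superAlg R) : Type := A.

Section AsModule.
Variables (R : superRingType) (A : superAlg R).
HB.instance Definition _ := GradedZmod.copy (asmod A) (salg A).

Definition asmod_scale (r : R) (x : asmod A) : asmod A :=
  (smap A r : A) * (x : A).

Fact asmod_scaleA a b v : asmod_scale a (asmod_scale b v) = asmod_scale (a * b) v.
Proof. by rewrite /asmod_scale mulrA rmorphM. Qed.
Fact asmod_scale1 : left_id 1 asmod_scale.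
Proof. by move=> x; rewrite /asmod_scale rmorph1 mul1r. Qed.
Fact asmod_scaleDr : right_distributive asmod_scale +%R.
Proof. by move=> a x y; rewrite /asmod_scale mulrDr. Qed.
Fact asmod_scaleDl v : {morph asmod_scale^~ v : a b / a + b}.
Proof. by move=> a b; rewrite /asmod_scale rmorphD mulrDl. Qed.
HB.instance Definition _ := GRing.Zmodule_isLmodule.Build R (asmod A)
  asmod_scaleA asmod_scale1 asmod_scaleDr asmod_scaleDl.

Fact asmod_homogZ i j (r : R) (x : asmod A) :
  homog i r -> homog j x -> homog (i (+) j) (r *: x).
Proof.
move=> hr hx; apply: (homogM (smap_even hr : homog i (smap A r)) (hx : homog j (x : A))).
Qed.
HB.instance Definition _ := Lmodule_isSuper.Build R (asmod A) asmod_homogZ.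

Lemma asmodZE (r : R) (x : asmod A) : r *: x = smap A r * (x : A).
Proof. by []. Qed.
End AsModule.

Definition sopp (A : superRingType) : Type := A.

Section Opposite.
Variable A : superRingType.
HB.instance Definition _ := GradedZmod.copy (sopp A) A.

Definition sopp_mul : sopp A -> sopp A -> sopp A :=
  ksum (fun x y : sopp A => (y : A) * (x : A)).

Fact sopp_biadd : biadditive (fun x y : sopp A => (y : A) * (x : A)).
Proof. by split=> [y a b|x a b]; rewrite (mulrDl, mulrDr). Qed.
Fact sopp_mulDl : left_distributive sopp_mul +%R.
Proof. by move=> x y z; apply: (ksumDl z sopp_biadd). Qed.
Fact sopp_mulDr : right_distributive sopp_mul +%R.
Proof. by move=> x y z; apply: (ksumDr x sopp_biadd). Qed.
Fact sopp_mul_homog i j (x y : sopp A) : homog i x -> homog j y ->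
  sopp_mul x y = sg (i && j) ((y : A) * (x : A)).
Proof. exact: (ksumE sopp_biadd). Qed.
Fact sopp_homogM i j (x y : sopp A) : homog i x -> homog j y ->
  homog (i (+) j) (sopp_mul x y).
Proof.
move=> hx hy; rewrite (sopp_mul_homog hx hy) addbC; apply: homog_sg.
exact: (homogM (hy : homog j (y : A)) (hx : homog i (x : A))).
Qed.
Fact sopp_mulA : associative sopp_mul.
Proof.
move=> x y z.
elim/homog_ind: x => [i x hx|x x' IHx IHx']; last by rewrite !sopp_mulDl IHx IHx'.
elim/homog_ind: y => [j y hy|y y' IHx IHx'];
  last by rewrite !(sopp_mulDl, sopp_mulDr) IHx IHx'.
elim/homog_ind: z => [k z hz|z z' IHx IHx']; last by rewrite !sopp_mulDr IHx IHx'.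
rewrite (sopp_mul_homog hx (sopp_homogM hy hz)) (sopp_mul_homog (sopp_homogM hx hy) hz).
rewrite (sopp_mul_homog hx hy) (sopp_mul_homog hy hz) sgMl sgMr mulrA !sgC.
by case: i {hx}; case: j {hy}; case: k {hz}.
Qed.
Fact sopp_mul1l : left_id (1 : A) sopp_mul.
Proof.
move=> x; elim/homog_ind: x => [i x hx|x x' IHx IHx']; last by rewrite !sopp_mulDr IHx IHx'.
by rewrite (sopp_mul_homog (homog1 A : homog false (1 : sopp A)) hx) mulr1.
Qed.
Fact sopp_mul1r : right_id (1 : A) sopp_mul.
Proof.
move=> x; elim/homog_ind: x => [i x hx|x x' IHx IHx']; last by rewrite !sopp_mulDl IHx IHx'.
by rewrite (sopp_mul_homog hx (homog1 A : homog false (1 : sopp A))) andbF mul1r.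
Qed.
HB.instance Definition _ := GRing.Zmodule_isPzRing.Build (sopp A)
  sopp_mulA sopp_mul1l sopp_mul1r sopp_mulDl sopp_mulDr.
HB.instance Definition _ := PzRing_isSuper.Build (sopp A) sopp_homogM.
End Opposite.

Lemma soppM (A : superRingType) i j (x y : sopp A) : homog i x -> homog j y ->
  x * y = sg (i && j) ((y : A) * (x : A)).
Proof. exact: sopp_mul_homog. Qed.

Section OppositeAlgebra.
Variables (R : superRingType) (A : superAlg R).
Definition sopp_map (r : R) : sopp A := smap A r.
Fact sopp_map_zmod : zmod_morphism sopp_map.
Proof. exact: (rmorphB (smap A)). Qed.
Fact sopp_map_even : even_map sopp_map.
Proof. exact: (@smap_even R A). Qed.
Fact sopp_mapD : {morph sopp_map : x y / x + y}.
Proof. exact: (rmorphD (smap A)). Qed.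
Fact sopp_map_monoid : monoid_morphism sopp_map.
Proof.
split; first exact: (rmorph1 (smap A)).
move=> x y; elim/homog_ind: x => [i x hx|x x' IHx IHx'];
  last by rewrite !(mulrDl, sopp_mapD) IHx IHx'.
elim/homog_ind: y => [j y hy|y y' IHy IHy'];
  last by rewrite !(mulrDr, sopp_mapD) IHy IHy'.
rewrite (soppM (sopp_map_even hx) (sopp_map_even hy)) /sopp_map.
by rewrite (smap_comm hx (smap_even hy)) sgC addbb rmorphM.
Qed.
HB.instance Definition _ := GRing.isZmodMorphism.Build R (sopp A) sopp_map sopp_map_zmod.
HB.instance Definition _ := GRing.isMonoidMorphism.Build R (sopp A) sopp_map sopp_map_monoid.
Fact sopp_map_central r : supercenter (sopp_map r).
Proof.
move=> i j a ha; have hr := homog_cpt j (sopp_map r).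
rewrite (soppM ha hr) (soppM hr ha) [j && i]andbC sgC addbb.
exact/esym/(smap_central A r i j a ha).
Qed.
Definition oppAlg : superAlg R := @SuperAlg R (sopp A) sopp_map sopp_map_even sopp_map_central.
End OppositeAlgebra.

(* A (x)_R N is the abelian group presented by the symbols a (x) n subject to
   biadditivity and (a i(r)) (x) n = a (x) (r n): finite formal sums of symbols,
   modulo the congruence these relations generate.  Opposites exist because
   - (a (x) n) = (- a) (x) n. *)
Section TensorDef.
Variables (R : superRingType) (A : superAlg R) (N : lmodType R).

Inductive tens_rel : seq (A * N) -> seq (A * N) -> Prop :=
| tens_refl s : tens_rel s s
| tens_sym s t : tens_rel s t -> tens_rel t s
| tens_trans s t u : tens_rel s t -> tens_rel t u -> tens_rel s u
| tens_cat s s' t t' : tens_rel s s' -> tens_rel t t' -> tens_rel (s ++ t) (s' ++ t')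
| tens_comm s t : tens_rel (s ++ t) (t ++ s)
| tens_0l n : tens_rel [:: (0, n)] [::]
| tens_addl a a' n : tens_rel [:: (a + a', n)] [:: (a, n); (a', n)]
| tens_addr a n n' : tens_rel [:: (a, n + n')] [:: (a, n); (a, n')]
| tens_bal a r n : tens_rel [:: (a * smap A r, n)] [:: (a, r *: n)].

Definition tens_relb : rel (seq (A * N)) := fun s t => `[< tens_rel s t >].
Fact tens_relb_refl : reflexive tens_relb.
Proof. by move=> s; apply/asboolP/tens_refl. Qed.
Fact tens_relb_sym : symmetric tens_relb.
Proof. by move=> s t; apply/asboolP/asboolP => /tens_sym. Qed.
Fact tens_relb_trans : transitive tens_relb.
Proof. by move=> t s u /asboolP st /asboolP tu; apply/asboolP/(tens_trans st tu). Qed.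
Canonical tens_equiv := EquivRel tens_relb tens_relb_refl tens_relb_sym tens_relb_trans.

Definition tens := {eq_quot tens_equiv}.
HB.instance Definition _ := Choice.on tens.
HB.instance Definition _ := EqQuotient.on tens.

Definition tpi (s : seq (A * N)) : tens := \pi_tens s.
Definition pure (a : A) (n : N) : tens := tpi [:: (a, n)].

Lemma tpiP s t : reflect (tens_rel s t) (tpi s == tpi t).
Proof. by rewrite /tpi eqmodE; apply: asboolP. Qed.
Lemma eq_tpi s t : tens_rel s t -> tpi s = tpi t.
Proof. by move=> st; apply/eqP/tpiP. Qed.
Lemma tpi_rel s t : tpi s = tpi t -> tens_rel s t.
Proof. by move=> /eqP/tpiP. Qed.
Lemma tpi_repr t : tpi (repr t) = t.
Proof. exact: reprK. Qed.

Definition tens_add (s t : tens) : tens := tpi (repr s ++ repr t).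
Definition tens_zero : tens := tpi [::].
Definition tens_opp (t : tens) : tens := tpi [seq (- p.1, p.2) | p <- repr t].

Lemma tpi_cat s t : tpi (s ++ t) = tens_add (tpi s) (tpi t).
Proof.
by apply: eq_tpi; apply: tens_cat; apply: tpi_rel; rewrite tpi_repr.
Qed.

Lemma tens_opp_rel s : tens_rel ([seq (- p.1, p.2) | p <- s] ++ s) [::].
Proof.
elim: s => [|[a n] s IHs] /=; first exact: tens_refl.
set m := [seq _ | p <- s] in IHs *.
have c := tens_comm ([:: (- a, n)] ++ m) [:: (a, n)].
have e1 : tens_rel ((- a, n) :: m ++ (a, n) :: s)
                   (([:: (a, n)] ++ [:: (- a, n)] ++ m) ++ s).
  by have := tens_cat c (tens_refl s); rewrite -!catA.
apply: (tens_trans e1).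
have e2 : tens_rel [:: (a, n); (- a, n)] [::].
  by apply: (tens_trans (tens_sym (tens_addl a (- a) n))); rewrite subrr; apply: tens_0l.
by have := tens_cat e2 IHs; rewrite -!catA.
Qed.

Fact tens_addA : associative tens_add.
Proof.
move=> s t u; rewrite -[s]tpi_repr -[t]tpi_repr -[u]tpi_repr.
by rewrite -!tpi_cat catA.
Qed.
Fact tens_addC : commutative tens_add.
Proof.
move=> s t; rewrite -[s]tpi_repr -[t]tpi_repr -!tpi_cat.
exact/eq_tpi/tens_comm.
Qed.
Fact tens_add0 : left_id tens_zero tens_add.
Proof. by move=> s; rewrite -[s]tpi_repr -tpi_cat. Qed.
Fact tens_addN : left_inverse tens_zero tens_opp tens_add.
Proof.
move=> s; rewrite -{2}[s]tpi_repr -tpi_cat.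
exact/eq_tpi/tens_opp_rel.
Qed.
HB.instance Definition _ := GRing.isZmodule.Build tens
  tens_addA tens_addC tens_add0 tens_addN.

Lemma tpiE s : tpi s = \sum_(p <- s) pure p.1 p.2.
Proof.
elim: s => [|[a n] s IHs]; first by rewrite big_nil.
by rewrite big_cons -cat1s tpi_cat IHs.
Qed.

Lemma pureDl a a' n : pure (a + a') n = pure a n + pure a' n.
Proof. by rewrite /pure -[RHS]tpi_cat; apply/eq_tpi/tens_addl. Qed.
Lemma pureDr a n n' : pure a (n + n') = pure a n + pure a n'.
Proof. by rewrite /pure -[RHS]tpi_cat; apply/eq_tpi/tens_addr. Qed.
Lemma pure_bal a r n : pure (a * smap A r) n = pure a (r *: n).
Proof. exact/eq_tpi/tens_bal. Qed.
Lemma pure0l n : pure 0 n = 0.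
Proof. exact/eq_tpi/tens_0l. Qed.
Lemma pure0r a : pure a 0 = 0.
Proof. by apply: (addrI (pure a 0)); rewrite -pureDr !addr0. Qed.
Lemma pure_sgl b a n : pure (sg b a) n = sg b (pure a n).
Proof.
case: b => //=; rewrite /sg.
by apply: (addrI (pure a n)); rewrite -pureDl !subrr pure0l.
Qed.
Lemma pure_sgr b a n : pure a (sg b n) = sg b (pure a n).
Proof.
case: b => //=; rewrite /sg.
by apply: (addrI (pure a n)); rewrite -pureDr !subrr pure0r.
Qed.

Definition balanced (Z : zmodType) (f : A -> N -> Z) : Prop :=
  [/\ forall n, {morph f^~ n : a b / a + b},
      forall a, {morph f a : m n / m + n}
    & forall a r n, f (a * smap A r) n = f a (r *: n)].

Definition tlift (Z : zmodType) (f : A -> N -> Z) (t : tens) : Z :=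
  \sum_(p <- repr t) f p.1 p.2.

Section Lift.
Variables (Z : zmodType) (f : A -> N -> Z).
Hypothesis fbal : balanced f.

Lemma tlift_rel s t : tens_rel s t ->
  \sum_(p <- s) f p.1 p.2 = \sum_(p <- t) f p.1 p.2.
Proof.
case: fbal => fDl fDr fb.
elim=> {s t} [//|s t _ -> //|s t u _ -> _ -> //|s s' t t' _ IHs _ IHt|s t|n|a a' n|a n n'|a r n].
- by rewrite !big_cat /= IHs IHt.
- by rewrite !big_cat /= addrC.
- rewrite big_seq1 big_nil /=; apply: (addrI (f 0 n)).
  by rewrite -[LHS]fDl !addr0.
- by rewrite !(big_cons, big_nil) /= !addr0 [LHS]fDl.
- by rewrite !(big_cons, big_nil) /= !addr0 fDr.
- by rewrite !big_seq1 /= fb.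
Qed.

Lemma tlift_tpi s : tlift f (tpi s) = \sum_(p <- s) f p.1 p.2.
Proof. by apply: tlift_rel; apply: tpi_rel; rewrite tpi_repr. Qed.
Lemma tliftE a n : tlift f (pure a n) = f a n.
Proof. by rewrite tlift_tpi big_seq1. Qed.
Lemma tliftD : {morph tlift f : s t / s + t}.
Proof.
move=> s t; rewrite -[s]tpi_repr -[t]tpi_repr -[_ + _]tpi_cat !tlift_tpi.
by rewrite big_cat.
Qed.
End Lift.

Lemma tens_ind0 (P : tens -> Prop) :
  (forall a n, P (pure a n)) -> (forall s t, P s -> P t -> P (s + t)) ->
  forall t, P t.
Proof.
move=> Pp PD t; rewrite -[t]tpi_repr tpiE.
elim: (repr t) => [|p s IHs]; first by rewrite big_nil -(pure0l 0).
by rewrite big_cons; apply: PD.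
Qed.
End TensorDef.

Arguments pure {R A N} a n.
Arguments tens {R} A N.

(* Parity of a (x) n is |a| + |n|. *)
Section TensorGrading.
Variables (R : superRingType) (A : superAlg R) (N : superLmodType R).

Lemma tens_ind (P : tens A N -> Prop) :
  (forall i j a n, homog i a -> homog j n -> P (pure a n)) ->
  (forall s t, P s -> P t -> P (s + t)) -> forall t, P t.
Proof.
move=> Pp PD; apply: tens_ind0 => // a n.
elim/homog_ind: a => [i a ha|a a' IHa IHa']; last by rewrite pureDl; apply: PD.
elim/homog_ind: n => [j n hn|n n' IHa IHa']; last by rewrite pureDr; apply: PD.
exact: Pp ha hn.
Qed.

Definition tens_cpt (k : bool) : tens A N -> tens A N :=
  tlift (fun a n => \sum_(i : bool) pure (cpt i a) (cpt (i (+) k) n)).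

Lemma cptM (B : superRingType) i j (x y : B) : homog j y ->
  cpt i (x * y) = cpt (i (+) j) x * y.
Proof.
move=> hy; elim/homog_ind: x => [k x hx|x x' IHx IHx']; last by rewrite !(mulrDl, cptD) IHx IHx'.
rewrite (cpt_homog _ (homogM hx hy)) (cpt_homog _ hx).
by case: i; case: j {hy}; case: k {hx}; rewrite /= ?mul0r.
Qed.
Lemma cptZ (M : superLmodType R) i j (r : R) (x : M) : homog j r ->
  cpt i (r *: x) = r *: cpt (i (+) j) x.
Proof.
move=> hr; elim/homog_ind: x => [k x hx|x x' IHx IHx']; last by rewrite !(scalerDr, cptD) IHx IHx'.
rewrite (cpt_homog _ (homogZ hr hx)) (cpt_homog _ hx).
by case: i; case: j {hr}; case: k {hx}; rewrite /= ?scaler0.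
Qed.

Fact tens_cpt_bal k :
  balanced (fun (a : A) (n : N) => \sum_(i : bool) pure (cpt i a) (cpt (i (+) k) n)).
Proof.
split=> [n a b|a m n|a r n].
- by rewrite /= -big_split; apply: eq_bigr => i _; rewrite cptD pureDl.
- by rewrite /= -big_split; apply: eq_bigr => i _; rewrite cptD pureDr.
elim/homog_ind: r => [j r hr|r r' IHr IHr']; last first.
  rewrite rmorphD mulrDr scalerDl.
  rewrite (eq_bigr (fun i => pure (cpt i (a * smap A r)) (cpt (i (+) k) n) +
     pure (cpt i (a * smap A r')) (cpt (i (+) k) n))); last first.
    by move=> i _; rewrite cptD pureDl.
  rewrite big_split /= IHr IHr' -big_split /=; apply: eq_bigr => i _.
  by rewrite cptD pureDr.
rewrite (reindex_inj (can_inj (addbK j))) /=.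
apply: eq_bigr => i _.
rewrite (cptM _ _ (smap_even hr)) pure_bal (cptZ _ _ hr).
by case: i; case: j {hr}; case: k.
Qed.

Lemma tens_cptE k a n :
  tens_cpt k (pure a n) = \sum_(i : bool) pure (cpt i a) (cpt (i (+) k) n).
Proof. exact: (tliftE (tens_cpt_bal k)). Qed.
Fact tens_cptD k s t : tens_cpt k (s + t) = tens_cpt k s + tens_cpt k t.
Proof. exact: (tliftD (tens_cpt_bal k)). Qed.
Lemma tens_cpt_homog k i j a n : homog i a -> homog j n ->
  tens_cpt k (pure a n) = if k == i (+) j then pure a n else 0.
Proof.
move=> ha hn; rewrite tens_cptE big_bool /=.
rewrite !(cpt_homog _ ha) !(cpt_homog _ hn).
by case: i {ha}; case: j {hn}; case: k; rewrite /= ?(pure0l, pure0r) ?addr0 ?add0r.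
Qed.
Fact tens_cpt_sum t : tens_cpt false t + tens_cpt true t = t.
Proof.
elim/tens_ind: t => [i j a n ha hn|s t IHs IHt].
  by rewrite !(tens_cpt_homog _ ha hn); case: (i (+) j); rewrite ?add0r ?addr0.
by rewrite !tens_cptD addrACA IHs IHt.
Qed.
Fact tens_cpt0 k : tens_cpt k 0 = 0.
Proof. by apply: (addrI (tens_cpt k 0)); rewrite -tens_cptD !addr0. Qed.
Fact tens_cptK k l t : tens_cpt k (tens_cpt l t) = if k == l then tens_cpt l t else 0.
Proof.
elim/tens_ind: t => [i j a n ha hn|s t IHs IHt].
  rewrite (tens_cpt_homog _ ha hn); case: (l =P _) => [->|_].
    by rewrite (tens_cpt_homog _ ha hn).
  by rewrite tens_cpt0; case: ifP.
by rewrite !tens_cptD IHs IHt; case: ifP; rewrite // addr0.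
Qed.
HB.instance Definition _ := isZ2Graded.Build (tens A N)
  tens_cptD tens_cpt_sum tens_cptK.

Lemma homog_pure i j a n : homog i a -> homog j n -> homog (i (+) j) (pure a n : tens A N).
Proof. by move=> ha hn; apply: etrans (tens_cpt_homog _ ha hn) _; rewrite eqxx. Qed.
End TensorGrading.

Definition stens (R : superRingType) (A B : superAlg R) : Type := tens A (asmod B).

Section TensorRing.
Variables (R : superRingType) (A B : superAlg R).
HB.instance Definition _ := GradedZmod.copy (stens A B) (tens A (asmod B)).
Implicit Types (a c : A) (b d : B) (s t u : stens A B).

Definition spure a b : stens A B := pure a (b : asmod B).

Definition stens_mul_pure a b c d : stens A B :=
  ksum (fun b c => spure (a * c) (b * d)) b c.
Local Notation lift := (tlift (A := A) (N := asmod B)).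
Definition stens_mul s t : stens A B :=
  lift (fun a b => lift (stens_mul_pure a b) t) s.

Lemma spureDl b : {morph spure^~ b : x y / x + y}.
Proof. by move=> x y; apply: pureDl. Qed.
Lemma spureDr a : {morph spure a : x y / x + y}.
Proof. by move=> x y; apply: pureDr. Qed.
Lemma spure_sgl e a b : spure (sg e a) b = sg e (spure a b).
Proof. exact: (hom_sg _ _ (spureDl b)). Qed.
Lemma spure_sgr e a b : spure a (sg e b) = sg e (spure a b).
Proof. exact: (hom_sg _ _ (spureDr a)). Qed.
Lemma spure_bal a r b : spure (a * smap A r) b = spure a (smap B r * b).
Proof. exact: (pure_bal a r (b : asmod B)). Qed.
Lemma homog_spure i j a b : homog i a -> homog j b -> homog (i (+) j) (spure a b).
Proof. exact: (@homog_pure R A (asmod B)). Qed.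

Fact stens_biadd a d : biadditive (fun b c => spure (a * c) (b * d)).
Proof.
split=> [y x x'|x y y'].
  by rewrite mulrDl spureDr.
by rewrite mulrDr spureDl.
Qed.

Lemma stens_mul_pureE i j a b c d : homog i b -> homog j c ->
  stens_mul_pure a b c d = sg (i && j) (spure (a * c) (b * d)).
Proof. exact: (ksumE (stens_biadd a d)). Qed.

Fact smul_pureDa b c d : {morph (fun a => stens_mul_pure a b c d) : x y / x + y}.
Proof. by move=> x y; apply: ksumDf => v w; rewrite mulrDl spureDl. Qed.
Fact smul_pureDb a c d : {morph (fun b => stens_mul_pure a b c d) : x y / x + y}.
Proof. exact: (ksumDl c (stens_biadd a d)). Qed.
Fact smul_pureDc a b d : {morph (fun c => stens_mul_pure a b c d) : x y / x + y}.
Proof. exact: (ksumDr b (stens_biadd a d)). Qed.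
Fact smul_pureDd a b c : {morph (fun d => stens_mul_pure a b c d) : x y / x + y}.
Proof. by move=> x y; apply: ksumDf => v w; rewrite mulrDr spureDr. Qed.

Fact smul_pure_bal a b : balanced (A := A) (N := asmod B) (stens_mul_pure a b).
Proof.
split=> [d|c|c r d].
- exact: smul_pureDc.
- exact: smul_pureDd.
rewrite asmodZE.
elim/homog_ind: r => [l r hr|r r' IH IH']; last first.
  by rewrite !rmorphD mulrDr mulrDl smul_pureDc smul_pureDd IH IH'.
elim/homog_ind: b => [i b hb|b b' IH IH']; last by rewrite !smul_pureDb IH IH'.
elim/homog_ind: c => [j c hc|c c' IH IH']; last by rewrite mulrDl !smul_pureDc IH IH'.
rewrite (stens_mul_pureE _ _ hb (homogM hc (smap_even hr))) (stens_mul_pureE _ _ hb hc).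
rewrite !mulrA spure_bal mulrA (smap_comm hr hb) -mulrA sgMl spure_sgr mulrA sgC.
by case: i {hb}; case: j {hc}; case: l {hr}.
Qed.

Fact smul_bal t : balanced (A := A) (N := asmod B)
  (fun a b => lift (stens_mul_pure a b) t).
Proof.
split=> [b x y|a x y|a r b].
- elim/tens_ind0: t => [c d|t t' IH IH'].
    by rewrite !(tliftE (smul_pure_bal _ _)) smul_pureDa.
  by rewrite !(tliftD (smul_pure_bal _ _)) IH IH' addrACA.
- elim/tens_ind0: t => [c d|t t' IH IH'].
    by rewrite !(tliftE (smul_pure_bal _ _)) smul_pureDb.
  by rewrite !(tliftD (smul_pure_bal _ _)) IH IH' addrACA.
rewrite asmodZE.
elim/tens_ind: t => [j k c d hc hd|t t' IH IH']; last first.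
  by rewrite !(tliftD (smul_pure_bal _ _)) IH IH'.
rewrite !(tliftE (smul_pure_bal _ _)).
elim/homog_ind: r => [l r hr|r r' IH IH']; last first.
  by rewrite !rmorphD mulrDr mulrDl smul_pureDa smul_pureDb IH IH'.
elim/homog_ind: b => [i b hb|b b' IH IH'].
  rewrite (stens_mul_pureE _ _ hb hc) (stens_mul_pureE _ _ (homogM (smap_even hr) hb) hc).
  rewrite -!mulrA -spure_bal -mulrA (smap_comm hr hc) sgMr spure_sgl sgC.
  by case: i {hb}; case: j {hc}; case: l {hr}.
by rewrite mulrDr !smul_pureDb IH IH'.
Qed.

Fact stens_mulDl : left_distributive stens_mul +%R.
Proof. by move=> s s' t; apply: (tliftD (smul_bal t)). Qed.
Fact stens_mulDr : right_distributive stens_mul +%R.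
Proof.
move=> s t t'; elim/tens_ind0: s => [a b|s s' IH IH'].
  by rewrite /stens_mul !(tliftE (smul_bal _)) (tliftD (smul_pure_bal _ _)).
by rewrite !stens_mulDl IH IH' addrACA.
Qed.
Fact stens_mulE i j a b c d : homog i b -> homog j c ->
  stens_mul (spure a b) (spure c d) = sg (i && j) (spure (a * c) (b * d)).
Proof.
move=> hb hc; rewrite -(stens_mul_pureE _ _ hb hc).
by rewrite /stens_mul (tliftE (smul_bal _)) (tliftE (smul_pure_bal _ _)).
Qed.

Lemma stens_ind (P : stens A B -> Prop) :
  (forall i j a b, homog i a -> homog j b -> P (spure a b)) ->
  (forall s t, P s -> P t -> P (s + t)) -> forall t, P t.
Proof. exact: (@tens_ind R A (asmod B)). Qed.

Fact stens_mulNl e s t : stens_mul (sg e s) t = sg e (stens_mul s t).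
Proof. exact: (hom_sg e s (fun x y => stens_mulDl x y t)). Qed.
Fact stens_mulNr e s t : stens_mul s (sg e t) = sg e (stens_mul s t).
Proof. exact: (hom_sg e t (stens_mulDr s)). Qed.

Fact stens_mulA : associative stens_mul.
Proof.
move=> s t u.
elim/stens_ind: s => [i j a b ha hb|s s' IH IH']; last by rewrite !stens_mulDl IH IH'.
elim/stens_ind: t => [k l c d hc hd|s s' IH IH'];
  last by rewrite !(stens_mulDr, stens_mulDl) IH IH'.
elim/stens_ind: u => [m n e f he hf|s s' IH IH']; last by rewrite !stens_mulDr IH IH'.
rewrite (stens_mulE _ _ hd he) (stens_mulE _ _ hb hc) stens_mulNl stens_mulNr.
rewrite (stens_mulE _ _ hb (homogM hc he)) (stens_mulE _ _ (homogM hb hd) he) !mulrA !sgC.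
by case: j {hb}; case: k {hc}; case: l {hd}; case: m {he}.
Qed.
Fact stens_mul1l : left_id (spure 1 1) stens_mul.
Proof.
move=> s; elim/stens_ind: s => [i j a b ha hb|s s' IH IH']; last by rewrite !stens_mulDr IH IH'.
by rewrite (stens_mulE _ _ (homog1 B) ha) !mul1r.
Qed.
Fact stens_mul1r : right_id (spure 1 1) stens_mul.
Proof.
move=> s; elim/stens_ind: s => [i j a b ha hb|s s' IH IH']; last by rewrite !stens_mulDl IH IH'.
by rewrite (stens_mulE _ _ hb (homog1 A)) !mulr1 andbF.
Qed.
HB.instance Definition _ := GRing.Zmodule_isPzRing.Build (stens A B)
  stens_mulA stens_mul1l stens_mul1r stens_mulDl stens_mulDr.

Lemma spureM i j a b c d : homog i b -> homog j c ->
  spure a b * spure c d = sg (i && j) (spure (a * c) (b * d)).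
Proof. exact: stens_mulE. Qed.

Lemma homog_stens_ind k (P : stens A B -> Prop) :
  (forall i a b, homog i a -> homog (i (+) k) b -> P (spure a b)) ->
  (forall s t, P s -> P t -> P (s + t)) -> forall t, homog k t -> P t.
Proof.
move=> Pp PD t <-.
have P0 : P 0.
  have := Pp false 0 0 (homog0 _ _) (homog0 _ _); congr P; exact: pure0l.
elim/stens_ind: t => [i j a b ha hb|s t IHs IHt]; last by rewrite cptD; apply: PD.
rewrite (cpt_homog _ (homog_spure ha hb)); case: eqP => // kE.
by apply: (Pp i) => //; rewrite kE addbA addbb.
Qed.

Fact stens_homogM i j s t : homog i s -> homog j t -> homog (i (+) j) (s * t).
Proof.
move=> hs ht; elim/homog_stens_ind: s / hs => [k a b ha hb|s s' IH IH'];
  last by rewrite mulrDl; apply: homogD.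
elim/homog_stens_ind: t / ht => [l c d hc hd|s s' IH IH'];
  last by rewrite mulrDr; apply: homogD.
rewrite (spureM _ _ hb hc); apply: homog_sg.
have := homog_spure (homogM ha hc) (homogM hb hd); congr (homog _ _).
by case: i {hb}; case: j {hd}; case: k {ha}; case: l {hc}.
Qed.
HB.instance Definition _ := PzRing_isSuper.Build (stens A B) stens_homogM.

Definition stens_map (r : R) : stens A B := spure (smap A r) 1.
Fact stens_map_zmod : zmod_morphism stens_map.
Proof.
move=> r r'; rewrite /stens_map; apply: (addIr (spure (smap A r') 1)).
by rewrite -spureDl addrNK -rmorphD addrNK.
Qed.
Fact stens_map_monoid : monoid_morphism stens_map.
Proof.
split=> [|r r']; rewrite /stens_map ?rmorph1 // rmorphM.
elim/homog_ind: r' => [i r' hr|x y IH IH'].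
  by rewrite (spureM _ _ (homog1 B) (smap_even hr)) mulr1.
by rewrite rmorphD mulrDr !spureDl IH IH' mulrDr.
Qed.
HB.instance Definition _ := GRing.isZmodMorphism.Build R (stens A B) stens_map stens_map_zmod.
HB.instance Definition _ := GRing.isMonoidMorphism.Build R (stens A B) stens_map stens_map_monoid.
Fact stens_map_even : even_map stens_map.
Proof.
by move=> i r hr; have := homog_spure (smap_even hr : homog i (smap A r)) (homog1 B); rewrite addbF.
Qed.
Fact stens_map_central r : supercenter (stens_map r).
Proof.
move=> i j s hs; rewrite -(even_cpt _ _ (raddfD stens_map) stens_map_even).
have := homog_cpt j r; move: (cpt j r) => {}r hr.
elim/homog_stens_ind: s / hs => [k a b ha hb|s s' IH IH'];
  last by rewrite mulrDl mulrDr sgD IH IH'.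
rewrite (spureM _ _ hb (smap_even hr)) (spureM _ _ (homog1 B) ha) (smap_comm hr ha).
rewrite mulr1 mul1r spure_sgl sgC.
by case: i {hb}; case: j {hr}; case: k {ha}.
Qed.
Definition tensAlg : superAlg R :=
  @SuperAlg R (stens A B) stens_map stens_map_even stens_map_central.
End TensorRing.

Arguments spure {R A B} a b.

(* Endomorphisms of A as a right R-module, a . r = a i(r). *)
Definition right_linear (R : superRingType) (A : superAlg R) (f : A -> A) : Prop :=
  {morph f : x y / x + y} /\ (forall x r, f (x * smap A r) = f x * smap A r).

Record sEnd (R : superRingType) (A : superAlg R) := SEnd {
  sEnd_fun :> A -> A;
  sEndP : right_linear sEnd_fun
}.

Section EndRing.
Variables (R : superRingType) (A : superAlg R).
Implicit Types (f g h : sEnd A).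
HB.instance Definition _ := gen_eqMixin (sEnd A).
HB.instance Definition _ := gen_choiceMixin (sEnd A).

Lemma sEnd_eq f g : f =1 g -> f = g.
Proof.
case: f g => [f pf] [g pg] /= /funext e; case: g / e in pg *.
by congr SEnd; apply: Prop_irrelevance.
Qed.
Lemma sEndD f : {morph f : x y / x + y}. Proof. by case: (sEndP f). Qed.
Lemma sEndR f x r : f (x * smap A r) = f x * smap A r. Proof. by case: (sEndP f). Qed.
Lemma sEnd0 f : f 0 = 0. Proof. exact: hom0 (sEndD f). Qed.

Program Definition sEnd_add f g : sEnd A := SEnd (sEnd_fun := fun x => f x + g x) _.
Next Obligation.
by split=> [x y|x r]; rewrite ?(sEndD f, sEndD g, sEndR) ?mulrDl // addrACA.
Qed.
Program Definition sEnd_zero : sEnd A := SEnd (sEnd_fun := fun=> 0) _.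
Next Obligation. by split=> [x y|x r]; rewrite ?addr0 ?mul0r. Qed.
Program Definition sEnd_opp f : sEnd A := SEnd (sEnd_fun := fun x => - f x) _.
Next Obligation.
by split=> [x y|x r]; rewrite ?(sEndD f, sEndR) ?opprD ?mulNr.
Qed.
Program Definition sEnd_one : sEnd A := SEnd (sEnd_fun := id) _.
Next Obligation. by []. Qed.
Program Definition sEnd_mul f g : sEnd A := SEnd (sEnd_fun := fun x => f (g x)) _.
Next Obligation.
by split=> [x y|x r]; rewrite ?(sEndD g) ?(sEndD f) ?sEndR.
Qed.
Fact sEnd_addA : associative sEnd_add.
Proof. by move=> f g h; apply: sEnd_eq => x /=; rewrite addrA. Qed.
Fact sEnd_addC : commutative sEnd_add.
Proof. by move=> f g; apply: sEnd_eq => x /=; rewrite addrC. Qed.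
Fact sEnd_add0 : left_id sEnd_zero sEnd_add.
Proof. by move=> f; apply: sEnd_eq => x /=; rewrite add0r. Qed.
Fact sEnd_addN : left_inverse sEnd_zero sEnd_opp sEnd_add.
Proof. by move=> f; apply: sEnd_eq => x /=; rewrite addNr. Qed.
HB.instance Definition _ := GRing.isZmodule.Build (sEnd A)
  sEnd_addA sEnd_addC sEnd_add0 sEnd_addN.
Fact sEnd_mulA : associative sEnd_mul.
Proof. by move=> f g h; apply: sEnd_eq. Qed.
Fact sEnd_mul1l : left_id sEnd_one sEnd_mul.
Proof. by move=> f; apply: sEnd_eq. Qed.
Fact sEnd_mul1r : right_id sEnd_one sEnd_mul.
Proof. by move=> f; apply: sEnd_eq. Qed.
Fact sEnd_mulDl : left_distributive sEnd_mul +%R.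
Proof. by move=> f g h; apply: sEnd_eq. Qed.
Fact sEnd_mulDr : right_distributive sEnd_mul +%R.
Proof. by move=> f g h; apply: sEnd_eq => x /=; rewrite sEndD. Qed.
HB.instance Definition _ := GRing.Zmodule_isPzRing.Build (sEnd A)
  sEnd_mulA sEnd_mul1l sEnd_mul1r sEnd_mulDl sEnd_mulDr.

Program Definition sEnd_cpt (k : bool) f : sEnd A :=
  SEnd (sEnd_fun := fun x => \sum_(j : bool) cpt (k (+) j) (f (cpt j x))) _.
Next Obligation.
split=> [x y|x r].
  by rewrite -big_split; apply: eq_bigr => j _ /=; rewrite !(cptD, sEndD f).
elim/homog_ind: r => [l r hr|r r' IH IH']; last first.
  rewrite rmorphD !mulrDr -IH -IH' -big_split; apply: eq_bigr => j _ /=.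
  by rewrite !(cptD, sEndD f).
rewrite mulr_suml (reindex_inj (can_inj (addbK l))) /=; apply: eq_bigr => j _.
rewrite (cptM _ _ (smap_even hr)) sEndR (cptM _ _ (smap_even hr)).
by case: k; case: j; case: l {hr}.
Qed.
Fact sEnd_cptD i f g : sEnd_cpt i (f + g) = sEnd_cpt i f + sEnd_cpt i g.
Proof.
by apply: sEnd_eq => x /=; rewrite -big_split; apply: eq_bigr => j _ /=; rewrite cptD.
Qed.
Lemma sEnd_cptE k i f x : homog i x -> sEnd_cpt k f x = cpt (k (+) i) (f x).
Proof.
move=> hx /=; rewrite big_bool /= !(cpt_homog _ hx).
by case: i {hx}; rewrite /= sEnd0 cpt0 ?addr0 ?add0r.
Qed.
Fact sEnd_cpt_sum f : sEnd_cpt false f + sEnd_cpt true f = f.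
Proof.
apply: sEnd_eq; elim/homog_ind => [i x hx|x y IH IH']; last by rewrite !sEndD IH IH'.
rewrite -[LHS]/(sEnd_cpt false f x + sEnd_cpt true f x) !(sEnd_cptE _ _ hx).
by case: i {hx} => /=; [rewrite addrC|]; apply: cpt_sum.
Qed.
Fact sEnd_cptK k l f : sEnd_cpt k (sEnd_cpt l f) = if k == l then sEnd_cpt l f else 0.
Proof.
apply: sEnd_eq; elim/homog_ind => [i x hx|x y IH IH']; last by rewrite !sEndD IH IH'.
rewrite (sEnd_cptE _ _ hx) (sEnd_cptE _ _ hx) cptK.
rewrite (fun_if (fun h : sEnd A => h x)) (sEnd_cptE _ _ hx).
by case: k; case: l; case: i {hx}.
Qed.
HB.instance Definition _ := isZ2Graded.Build (sEnd A) sEnd_cptD sEnd_cpt_sum sEnd_cptK.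

Lemma homog_sEnd k f :
  homog k f <-> (forall i x, homog i x -> homog (k (+) i) (f x)).
Proof.
split=> [hf i x hx|hf].
  by rewrite -{1}hf [cpt k f x](sEnd_cptE _ _ hx); apply: homog_cpt.
apply: sEnd_eq; elim/homog_ind => [i x hx|x y IH IH']; last by rewrite !sEndD IH IH'.
by rewrite [LHS](sEnd_cptE _ _ hx); apply: hf.
Qed.

Fact sEnd_homogM i j f g : homog i f -> homog j g -> homog (i (+) j) (f * g).
Proof.
move=> /homog_sEnd hf /homog_sEnd hg; apply/homog_sEnd => k x hx.
by rewrite -addbA; apply/hf/hg.
Qed.
HB.instance Definition _ := PzRing_isSuper.Build (sEnd A) sEnd_homogM.

Program Definition sEnd_map (r : R) : sEnd A :=
  SEnd (sEnd_fun := fun x => smap A r * x) _.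
Next Obligation. by split=> [x y|x r']; rewrite ?mulrDr ?mulrA. Qed.
Fact sEnd_map_zmod : zmod_morphism sEnd_map.
Proof. by move=> r r'; apply: sEnd_eq => x /=; rewrite rmorphB mulrBl. Qed.
Fact sEnd_map_monoid : monoid_morphism sEnd_map.
Proof.
by split=> [|r r']; apply: sEnd_eq => x /=; rewrite ?rmorph1 ?mul1r // rmorphM mulrA.
Qed.
HB.instance Definition _ := GRing.isZmodMorphism.Build R (sEnd A) sEnd_map sEnd_map_zmod.
HB.instance Definition _ := GRing.isMonoidMorphism.Build R (sEnd A) sEnd_map sEnd_map_monoid.
Fact sEnd_map_even : even_map sEnd_map.
Proof.
by move=> i r hr; apply/homog_sEnd => j x hx; apply: homogM (smap_even hr) hx.
Qed.
Fact sEnd_map_central r : supercenter (sEnd_map r).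
Proof.
move=> i j f /homog_sEnd hf; rewrite -(even_cpt _ _ (raddfD sEnd_map) sEnd_map_even).
have := homog_cpt j r; move: (cpt j r) => {}r hr.
apply: sEnd_eq; elim/homog_ind => [k x hx|x y IH IH']; last by rewrite !sEndD IH IH'.
have sgE b (h : sEnd A) y : sg b h y = sg b (h y) by case: b.
rewrite sgE /= -[smap A r * x](sgK (j && k)) -(smap_comm hr hx) (hom_sg _ _ (sEndD f)) sEndR.
rewrite (smap_comm hr (hf _ _ hx)) sgC.
by case: i {hf}; case: j {hr}; case: k {hx}.
Qed.
Definition sEndAlg : superAlg R :=
  @SuperAlg R (sEnd A) sEnd_map sEnd_map_even sEnd_map_central.
End EndRing.

Notation env A := (tensAlg A (oppAlg A)).

Section Phi.
Variables (R : superRingType) (A : superAlg R).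
Implicit Types (a x y : A) (b : oppAlg A).

Fact phi_biadd a : biadditive (fun b x => a * x * (b : A)).
Proof. by split=> [x b b'|b x x']; rewrite ?mulrDr // mulrDl. Qed.

Fact phi_right_linear a b : right_linear (ksum (fun b x => a * x * (b : A)) b).
Proof.
split=> [x y|x r]; first exact: (ksumDr b (phi_biadd a)).
have Dr := ksumDr _ (phi_biadd a); have Dl := ksumDl _ (phi_biadd a).
elim/homog_ind: r => [l r hr|r r' IH IH']; last by rewrite rmorphD !mulrDr Dr IH IH'.
elim/homog_ind: x => [j x hx|x x' IH IH']; last by rewrite mulrDl !Dr IH IH' mulrDl.
elim/homog_ind: b => [i b hb|b b' IH IH']; last by rewrite !Dl IH IH' mulrDl.
rewrite (ksumE (phi_biadd a) hb (homogM hx (smap_even hr))) (ksumE (phi_biadd a) hb hx).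
rewrite sgMl -!mulrA (smap_comm hr (hb : homog i (b : A))) !sgMr sgC.
by case: i {hb}; case: j {hx}; case: l {hr}.
Qed.

Definition phi_pure a b : sEnd A := SEnd (phi_right_linear a b).

(* phi (a (x) b) x = (-1)^{|b||x|} a x b; see phiE. *)
Definition phi : env A -> sEndAlg A :=
  tlift (A := A) (N := asmod (oppAlg A)) phi_pure.

Lemma phi_pureE i j a b x : homog i b -> homog j x ->
  phi_pure a b x = sg (i && j) (a * x * (b : A)).
Proof. exact: (ksumE (phi_biadd a)). Qed.
Fact phi_pureDb a : {morph phi_pure a : b b' / b + b'}.
Proof. by move=> b b'; apply: sEnd_eq => x; apply: (ksumDl x (phi_biadd a)). Qed.
Fact phi_pureDa b : {morph phi_pure^~ b : a a' / a + a'}.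
Proof.
by move=> a a'; apply: sEnd_eq => x; apply: ksumDf => v w; rewrite !mulrDl.
Qed.
Fact phi_bal : balanced (A := A) (N := asmod (oppAlg A)) phi_pure.
Proof.
split=> [n|a|a r b]; [exact: phi_pureDa|exact: phi_pureDb|].
rewrite asmodZE.
elim/homog_ind: r => [l r hr|r r' IH IH'].
  2: by rewrite !rmorphD mulrDr mulrDl phi_pureDb phi_pureDa IH IH'.
elim/homog_ind: b => [i b hb|b b' IH IH'].
  2: by rewrite mulrDr !phi_pureDb IH IH'.
apply: sEnd_eq; elim/homog_ind => [j x hx|x y IH IH']; last by rewrite !sEndD IH IH'.
have hr' : homog l (smap (oppAlg A) r) := smap_even hr.
rewrite (phi_pureE _ hb hx) (phi_pureE _ (homogM hr' hb) hx).
rewrite (soppM hr' hb) (smap_comm hr (hb : homog i (b : A))) sgC.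
rewrite sgMr sgC [a * x * _]mulrA -[a * x * smap A r]mulrA (smap_comm hr hx) sgMr sgMl sgC.
rewrite -!mulrA.
by case: i {hb}; case: j {hx}; case: l {hr hr'}.
Qed.
Lemma phiE i j a b x : homog i b -> homog j x ->
  phi (spure a b) x = sg (i && j) (a * x * (b : A)).
Proof. by move=> hb hx; rewrite /phi (tliftE phi_bal); apply: phi_pureE. Qed.
Fact phiD : {morph phi : s t / s + t}.
Proof. exact: (tliftD phi_bal). Qed.
Fact phi_zmod : zmod_morphism phi.
Proof. by move=> s t; apply: (addIr (phi t)); rewrite -phiD !addrNK. Qed.
Fact phi_monoid : monoid_morphism phi.
Proof.
split=> [|s t].
  apply: sEnd_eq; elim/homog_ind => [j x hx|x y IH IH']; last by rewrite !sEndD IH IH'.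
  by rewrite (phiE _ (homog1 (oppAlg A)) hx) mul1r mulr1.
elim/stens_ind: s => [i j a b ha hb|s s' IH IH']; last by rewrite !(mulrDl, phiD) IH IH'.
elim/stens_ind: t => [k l c d hc hd|s s' IH IH']; last by rewrite !(mulrDr, phiD) IH IH'.
apply: sEnd_eq; elim/homog_ind => [m x hx|x y IH IH']; last by rewrite !sEndD IH IH'.
rewrite (spureM _ _ hb hc) (hom_sg _ _ phiD) [RHS](_ : _ = phi (spure a b) (phi (spure c d) x)) //.
have sgE e (h : sEnd A) y : sg e h y = sg e (h y) by case: e.
rewrite sgE (phiE _ (homogM hb hd) hx) (phiE _ hd hx) (hom_sg _ _ (sEndD _)).
rewrite (phiE _ hb (homogM (homogM hc hx) (hd : homog l (d : A)))).
rewrite (soppM hb hd) sgMr !sgC !mulrA.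
by case: j {hb}; case: k {hc}; case: l {hd}; case: m {hx}.
Qed.
HB.instance Definition _ := GRing.isZmodMorphism.Build (env A) (sEndAlg A) phi phi_zmod.
HB.instance Definition _ := GRing.isMonoidMorphism.Build (env A) (sEndAlg A) phi phi_monoid.
Fact phi_even : even_map phi.
Proof.
move=> k t; elim/homog_stens_ind => [i a b ha hb|s s']; last by rewrite phiD; apply: homogD.
apply/homog_sEnd => j x hx; rewrite (phiE _ hb hx); apply: homog_sg.
have := homogM (homogM ha hx) (hb : homog _ (b : A)); congr (homog _ _).
by case: i {ha hb}; case: j {hx}; case: k.
Qed.
End Phi.

(* A (x)_R N as a left A^e-module, s (x (x) n) = (phi s x) (x) n. *)
Section TensorModule.
Variables (R : superRingType) (A : superAlg R) (N : superLmodType R).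

Definition tens_end (f : sEnd A) : tens A N -> tens A N :=
  tlift (A := A) (N := N) (fun x n => pure (f x) n).
Fact tens_end_bal (f : sEnd A) : balanced (fun (x : A) (n : N) => pure (f x) n : tens A N).
Proof.
split=> [n x y|x m n|x r n] /=; first by rewrite sEndD pureDl.
  exact: pureDr.
by rewrite sEndR pure_bal.
Qed.
Lemma tens_endE (f : sEnd A) x n : tens_end f (pure x n) = pure (f x) n.
Proof. exact: (tliftE (tens_end_bal f)). Qed.
Lemma tens_endD (f : sEnd A) : {morph tens_end f : s t / s + t}.
Proof. exact: (tliftD (tens_end_bal f)). Qed.

Definition tens_scale (s : env A) (t : tens A N) : tens A N := tens_end (phi s) t.
Fact tens_scaleA s s' t : tens_scale s (tens_scale s' t) = tens_scale (s * s') t.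
Proof.
rewrite /tens_scale; elim/tens_ind0: t => [x n|t t' IH IH']; last by rewrite !tens_endD IH IH'.
by rewrite !tens_endE rmorphM.
Qed.
Fact tens_scale1 : left_id 1 tens_scale.
Proof.
move=> t; rewrite /tens_scale; elim/tens_ind0: t => [x n|t t' IH IH']; last by rewrite !tens_endD IH IH'.
by rewrite !tens_endE rmorph1.
Qed.
Fact tens_scaleDr : right_distributive tens_scale +%R.
Proof. by move=> s t t'; apply: tens_endD. Qed.
Fact tens_scaleDl t : {morph tens_scale^~ t : s s' / s + s'}.
Proof.
move=> s s'; rewrite /tens_scale; elim/tens_ind0: t => [x n|t t' IH IH'].
  by rewrite !tens_endE phiD -pureDl.
by rewrite !tens_endD IH IH' addrACA.
Qed.
HB.instance Definition _ := GRing.Zmodule_isLmodule.Build (env A) (tens A N)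
  tens_scaleA tens_scale1 tens_scaleDr tens_scaleDl.
Lemma tens_scaleE (s : env A) x n : s *: (pure x n : tens A N) = pure (phi s x) n.
Proof. exact: tens_endE. Qed.

Lemma homog_tens_ind k (P : tens A N -> Prop) :
  (forall i a n, homog i a -> homog (i (+) k) n -> P (pure a n)) ->
  (forall s t, P s -> P t -> P (s + t)) -> forall t, homog k t -> P t.
Proof.
move=> Pp PD t <-.
have P0 : P 0.
  have := Pp false 0 0 (homog0 _ _) (homog0 _ _); congr P; exact: pure0l.
elim/tens_ind: t => [i j a b ha hb|s t IHs IHt]; last by rewrite cptD; apply: PD.
rewrite (cpt_homog _ (homog_pure ha hb)); case: eqP => // kE.
by apply: (Pp i) => //; rewrite kE addbA addbb.
Qed.
Fact tens_homogZ i j (s : env A) (t : tens A N) :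
  homog i s -> homog j t -> homog (i (+) j) (s *: t).
Proof.
move=> /phi_even/homog_sEnd hs; elim/homog_tens_ind => [k a n ha hn|t1 t2 h1 h2].
  rewrite tens_scaleE; have := homog_pure (hs _ _ ha) hn; congr (homog _ _).
  by case: i {hs}; case: j {hn}; case: k {ha}.
by rewrite scalerDr; apply: homogD.
Qed.
HB.instance Definition _ := Lmodule_isSuper.Build (env A) (tens A N) tens_homogZ.
End TensorModule.

(* An A^e-module as an (A,A)-bimodule:
   a . m = (a (x) 1) m and m . a = (-1)^{|a||m|} (1 (x) a) m. *)
Section Supercommutant.
Variables (R : superRingType) (A : superAlg R) (M : superLmodType (env A)).
Implicit Types (a : A) (r : R) (m : M).

Definition lact a m : M := (spure a 1 : env A) *: m.
Definition ract m a : M :=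
  ksum (fun m (a : oppAlg A) => (spure 1 a : env A) *: m) m (a : oppAlg A).

Fact ract_biadd : biadditive (fun m (a : oppAlg A) => (spure 1 a : env A) *: m).
Proof.
by split=> [a m m'|m a a']; rewrite ?scalerDr // spureDr scalerDl.
Qed.
Lemma ractE i j m a : homog i m -> homog j a ->
  ract m a = sg (i && j) ((spure 1 (a : oppAlg A) : env A) *: m).
Proof. exact: (ksumE ract_biadd). Qed.
Lemma lactD a : {morph lact a : m m' / m + m'}.
Proof. by move=> m m'; apply: scalerDr. Qed.
Lemma lactDl m : {morph lact^~ m : a a' / a + a'}.
Proof. by move=> a a'; rewrite /lact spureDl scalerDl. Qed.
Lemma ractD a : {morph ract^~ a : m m' / m + m'}.
Proof. exact: (ksumDl (a : oppAlg A) ract_biadd). Qed.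
Lemma ractDr m : {morph ract m : a a' / a + a'}.
Proof. exact: (ksumDr m ract_biadd). Qed.

Definition supercommutes i m : Prop :=
  forall j a, homog j a -> lact a m = sg (j && i) (ract m a).

(* The sub-(R,R)-bimodule of M generated by the homogeneous elements
   supercommuting with A. *)
Inductive commutant : M -> Prop :=
| commutant_gen i m : homog i m -> supercommutes i m -> commutant m
| commutant0 : commutant 0
| commutantD m m' : commutant m -> commutant m' -> commutant (m + m')
| commutantZl r m : commutant m -> commutant (lact (smap A r) m)
| commutantZr r m : commutant m -> commutant (ract m (smap A r)).

Definition commutantb : {pred M} := fun m => `[< commutant m >].

Lemma homog_lact i j a m : homog i a -> homog j m -> homog (i (+) j) (lact a m).
Proof.
move=> ha hm; apply: homogZ hm; rewrite -[i]addbF.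
exact: (homog_spure ha (homog1 _)).
Qed.
Lemma homog_ract i j a m : homog i a -> homog j m -> homog (i (+) j) (ract m a).
Proof.
move=> ha hm; rewrite (ractE hm ha); apply: homog_sg; apply: homogZ hm.
exact: (homog_spure (homog1 _) (ha : homog i (a : oppAlg A))).
Qed.

Fact commutant_cpt k m : commutant m -> commutant (cpt k m).
Proof.
move=> h; elim: h k => {m} [i m hm cm||m m' _ IH _ IH'|r m _ IH|r m _ IH] k.
- rewrite (cpt_homog _ hm); case: ifP => _; [exact: commutant_gen cm|exact: commutant0].
- by rewrite cpt0; apply: commutant0.
- by rewrite cptD; apply: commutantD.
- elim/homog_ind: r => [i r hr|r r' IHr IHr'].
    have h : homog i (spure (smap A r) 1 : env A).
      by rewrite -[i]addbF; apply: homog_spure (smap_even hr) (homog1 _).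
    by rewrite /lact (cptZ _ _ h); apply: commutantZl.
  by rewrite rmorphD lactDl cptD; apply: commutantD.
elim/homog_ind: r => [i r hr|r r' IHr IHr']; last first.
  by rewrite rmorphD ractDr cptD; apply: commutantD.
have e l : cpt k (ract (cpt l m) (smap A r)) =
           if k == l (+) i then ract (cpt l m) (smap A r) else 0.
  by rewrite addbC; apply: cpt_homog; apply: homog_ract (smap_even hr) (homog_cpt _ _).
rewrite -[m]cpt_sum ractD cptD !e; apply: commutantD.
  by case: ifP => _; [apply: commutantZr|apply: commutant0].
by case: ifP => _; [apply: commutantZr|apply: commutant0].
Qed.

Fact commutantb_zmod : zmod_closed commutantb.
Proof.
split=> [|m m' /asboolP h /asboolP h']; apply/asboolP; first exact: commutant0.
apply: commutantD => //.
have e : spure (-1) 1 = -1 :> env A := hom_sg true 1 (spureDl 1).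
by have := commutantZl (-1) h'; rewrite /lact rmorphN1 e scaleN1r.
Qed.
HB.instance Definition _ := GRing.isZmodClosed.Build M commutantb commutantb_zmod.

Record scomm := SComm { scomm_val : M; scommP : commutantb scomm_val }.
HB.instance Definition _ := [isSub for scomm_val].
HB.instance Definition _ := [Choice of scomm by <:].
HB.instance Definition _ := [SubChoice_isSubZmodule of scomm by <:].

Lemma scomm_in (x : scomm) : commutant (scomm_val x).
Proof. exact/asboolP/scommP. Qed.
Lemma scomm_eq (x y : scomm) : scomm_val x = scomm_val y -> x = y.
Proof. exact: val_inj. Qed.
Lemma scomm_valD (x y : scomm) : scomm_val (x + y) = scomm_val x + scomm_val y.
Proof. by []. Qed.
Lemma scomm_val0 : scomm_val 0 = 0.
Proof. by []. Qed.

Definition scomm_scale r (x : scomm) : scomm :=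
  SComm (asboolT (commutantZl r (scomm_in x))).
Fact scomm_scaleA r r' x : scomm_scale r (scomm_scale r' x) = scomm_scale (r * r') x.
Proof.
apply: scomm_eq; rewrite /= /lact scalerA.
by congr (_ *: _); exact: esym ((stens_map_monoid A (oppAlg A)).2 r r').
Qed.
Fact scomm_scale1 : left_id 1 scomm_scale.
Proof. by move=> x; apply: scomm_eq; rewrite /= /lact rmorph1 scale1r. Qed.
Fact scomm_scaleDr : right_distributive scomm_scale +%R.
Proof. by move=> r x y; apply: scomm_eq; apply: lactD. Qed.
Fact scomm_scaleDl x : {morph scomm_scale^~ x : r r' / r + r'}.
Proof. by move=> r r'; apply: scomm_eq; rewrite /= rmorphD lactDl. Qed.
HB.instance Definition _ := GRing.Zmodule_isLmodule.Build R scomm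
  scomm_scaleA scomm_scale1 scomm_scaleDr scomm_scaleDl.

Definition scomm_cpt k (x : scomm) : scomm :=
  SComm (asboolT (commutant_cpt k (scomm_in x))).
Fact scomm_cptD k x y : scomm_cpt k (x + y) = scomm_cpt k x + scomm_cpt k y.
Proof. by apply: scomm_eq; apply: cptD. Qed.
Fact scomm_cpt_sum x : scomm_cpt false x + scomm_cpt true x = x.
Proof. by apply: scomm_eq; apply: cpt_sum. Qed.
Fact scomm_cptK i j x :
  scomm_cpt i (scomm_cpt j x) = if i == j then scomm_cpt j x else 0.
Proof. by apply: scomm_eq; rewrite /= cptK; case: ifP. Qed.
HB.instance Definition _ := isZ2Graded.Build scomm
  scomm_cptD scomm_cpt_sum scomm_cptK.
Lemma homog_scomm i (x : scomm) : homog i x <-> homog i (scomm_val x).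
Proof. by split=> [e|e]; [rewrite /homog -{2}e|apply: scomm_eq]. Qed.
Fact scomm_homogZ i j r (x : scomm) : homog i r -> homog j x -> homog (i (+) j) (r *: x).
Proof.
move=> hr /homog_scomm hx; apply/homog_scomm.
exact: homog_lact (smap_even hr) hx.
Qed.
HB.instance Definition _ := Lmodule_isSuper.Build R scomm scomm_homogZ.
End Supercommutant.

Record category := Category {
  obj :> Type;
  hom : obj -> obj -> Type;
  idm : forall X, hom X X;
  compm : forall X Y Z, hom Y Z -> hom X Y -> hom X Z;
  compm1 : forall X Y (f : hom X Y), compm f (idm X) = f;
  comp1m : forall X Y (f : hom X Y), compm (idm Y) f = f;
  compmA : forall X Y Z T (f : hom Z T) (g : hom Y Z) (h : hom X Y),
    compm f (compm g h) = compm (compm f g) h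
}.
Arguments idm {c} X.
Arguments compm {c X Y Z}.

Record functor (C D : category) := Functor {
  fobj :> C -> D;
  fmap : forall X Y, hom X Y -> hom (fobj X) (fobj Y);
  fmap1 : forall X, fmap (idm X) = idm (fobj X);
  fmapM : forall X Y Z (f : hom Y Z) (g : hom X Y),
    fmap (compm f g) = compm (fmap f) (fmap g)
}.
Arguments fmap {C D} _ {X Y}.

Definition id_functor (C : category) : functor C C :=
  @Functor C C id (fun X Y f => f) (fun X => erefl) (fun X Y Z f g => erefl).

Program Definition comp_functor (C D E : category) (G : functor D E) (F : functor C D) :
  functor C E := @Functor C E (fun X => G (F X)) (fun X Y f => fmap G (fmap F f)) _ _.
Next Obligation. by rewrite !fmap1. Qed.
Next Obligation. by rewrite !fmapM. Qed.

Definition is_iso (C : category) (X Y : C) (f : hom X Y) : Prop :=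
  exists g : hom Y X, compm g f = idm X /\ compm f g = idm Y.

Definition naturally_isomorphic (C D : category) (F G : functor C D) : Prop :=
  exists eta : forall X, hom (F X) (G X),
    (forall X Y (f : hom X Y), compm (eta Y) (fmap F f) = compm (fmap G f) (eta X)) /\
    (forall X, is_iso (eta X)).

Definition mutually_inverse_equivalences (C D : category)
    (F : functor C D) (G : functor D C) : Prop :=
  naturally_isomorphic (comp_functor G F) (id_functor C) /\
  naturally_isomorphic (comp_functor F G) (id_functor D).

Record smHom (R : superRingType) (M N : superLmodType R) := SmHom {
  smfun :> M -> N;
  smfun_linear : linear smfun;
  smfun_even : even_map smfun
}.
Arguments smfun_linear {R M N} _.
Arguments smfun_even {R M N} _ [i x].

Section SmHom.
Variable R : superRingType.
Implicit Types M N P : superLmodType R.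

Lemma smHom_eq M N (f g : smHom M N) : f =1 g -> f = g.
Proof.
case: f g => [f lf ef] [g lg eg] /= /funext e; case: g / e in lg eg *.
by congr SmHom; apply: Prop_irrelevance.
Qed.
Lemma smfunD M N (f : smHom M N) : {morph f : x y / x + y}.
Proof. by move=> x y; have := smfun_linear f 1 x y; rewrite !scale1r. Qed.
Lemma smfun0 M N (f : smHom M N) : f 0 = 0.
Proof. exact: hom0 (smfunD f). Qed.
Lemma smfunZ M N (f : smHom M N) r x : f (r *: x) = r *: f x.
Proof. by have := smfun_linear f r x 0; rewrite smfun0 !addr0. Qed.

Program Definition sm_id M : smHom M M := SmHom (smfun := id) _ _.
Next Obligation. by []. Qed.
Next Obligation. by []. Qed.
Program Definition sm_comp M N P (f : smHom N P) (g : smHom M N) : smHom M P :=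
  SmHom (smfun := fun x => f (g x)) _ _.
Next Obligation. by move=> a x y; rewrite !smfun_linear. Qed.
Next Obligation. by move=> i x hx; do 2!apply: smfun_even. Qed.
End SmHom.

Program Definition smod (R : superRingType) : category :=
  @Category (superLmodType R) (@smHom R) (@sm_id R) (@sm_comp R) _ _ _.
Next Obligation. exact: smHom_eq. Qed.
Next Obligation. exact: smHom_eq. Qed.
Next Obligation. exact: smHom_eq. Qed.

Section Functors.
Variables (R : superRingType) (A : superAlg R).

Section TensorMap.
Variables (M N : superLmodType R) (f : smHom M N).
Definition tens_map : tens A M -> tens A N :=
  tlift (A := A) (N := M) (fun a m => pure a (f m)).
Fact tens_map_bal : balanced (fun (a : A) (m : M) => pure a (f m) : tens A N).
Proof.
split=> [m a b|a m n|a r m]; first exact: pureDl.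
  by rewrite /= smfunD pureDr.
by rewrite pure_bal smfunZ.
Qed.
Lemma tens_mapE a m : tens_map (pure a m) = pure a (f m).
Proof. exact: (tliftE tens_map_bal). Qed.
Lemma tens_mapD : {morph tens_map : s t / s + t}.
Proof. exact: (tliftD tens_map_bal). Qed.
Fact tens_map_linear : linear (tens_map : tens A M -> tens A N).
Proof.
move=> s t t'; rewrite tens_mapD; congr (_ + _).
elim/tens_ind0: t => [a m|u v IH IH'].
  by rewrite tens_scaleE !tens_mapE tens_scaleE.
by rewrite scalerDr !tens_mapD IH IH' scalerDr.
Qed.
Fact tens_map_even : even_map tens_map.
Proof.
move=> k t; elim/homog_tens_ind => [i a m ha hm|s s' h h'].
  rewrite tens_mapE; have := homog_pure ha (smfun_even f hm); congr (homog _ _).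
  by rewrite addbA addbb.
by rewrite tens_mapD; apply: homogD.
Qed.
Definition tens_hom : smHom (tens A M) (tens A N) := SmHom tens_map_linear tens_map_even.
End TensorMap.

Program Definition tensor_functor : functor (smod R) (smod (env A)) :=
  @Functor (smod R) (smod (env A)) (fun N : superLmodType R => tens A N : superLmodType (env A))
    (fun M N f => tens_hom f) _ _.
Next Obligation.
apply: smHom_eq => t /=; elim/tens_ind0: t => [a m|s t IH IH'].
  by rewrite tens_mapE.
by rewrite tens_mapD IH IH'.
Qed.
Next Obligation.
apply: smHom_eq => t /=; elim/tens_ind0: t => [a m|s t IH IH'].
  by rewrite !tens_mapE.
by rewrite !tens_mapD IH IH'.
Qed.

Section CommutantMap.
Variables (M N : superLmodType (env A)) (f : smHom M N).
Lemma smfun_lact a m : f (lact a m) = lact a (f m).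
Proof. exact: smfunZ. Qed.
Lemma smfun_ract m a : f (ract m a) = ract (f m) a.
Proof.
elim/homog_ind: m => [i m hm|m m' IH IH']; last by rewrite !(smfunD, ractD) IH IH'.
elim/homog_ind: a => [j a ha|a a' IH IH']; last by rewrite !(smfunD, ractDr) IH IH'.
rewrite (ractE hm ha) (ractE (smfun_even f hm) ha).
by rewrite (hom_sg _ _ (smfunD f)) smfunZ.
Qed.
Fact commutant_map m : commutant m -> commutant (f m).
Proof.
elim=> {m} [i m hm cm||m m' _ IH _ IH'|r m _ IH|r m _ IH].
- apply: (commutant_gen (smfun_even f hm)) => j a ha.
  by rewrite -smfun_lact (cm _ _ ha) (hom_sg _ _ (smfunD f)) smfun_ract.
- by rewrite smfun0; apply: commutant0.
- by rewrite smfunD; apply: commutantD.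
- by rewrite smfun_lact; apply: commutantZl.
- by rewrite smfun_ract; apply: commutantZr.
Qed.
Definition scomm_map (x : scomm M) : scomm N :=
  SComm (asboolT (commutant_map (scomm_in x))).
Fact scomm_map_linear : linear scomm_map.
Proof.
by move=> r x y; apply: scomm_eq; rewrite /= smfunD smfun_lact.
Qed.
Fact scomm_map_even : even_map scomm_map.
Proof. by move=> i x /homog_scomm hx; apply/homog_scomm; apply: (smfun_even f hx). Qed.
Definition scomm_hom : smHom (scomm M) (scomm N) :=
  SmHom scomm_map_linear scomm_map_even.
End CommutantMap.

Program Definition commutant_functor : functor (smod (env A)) (smod R) :=
  @Functor (smod (env A)) (smod R)
    (fun M : superLmodType (env A) => scomm M : superLmodType R)
    (fun M N f => scomm_hom f) _ _.
Next Obligation. by apply: smHom_eq => x; apply: scomm_eq. Qed.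
Next Obligation. by apply: smHom_eq => x; apply: scomm_eq. Qed.
End Functors.

Section Azumaya.
Variable R : superRingType.

Definition faithful (M : superLmodType R) : Prop :=
  forall r : R, (forall x : M, r *: x = 0) -> r = 0.

Definition finitely_generated (M : superLmodType R) : Prop :=
  exists (n : nat) (e : 'I_n -> M),
    forall x, exists c : 'I_n -> R, x = \sum_(k < n) c k *: e k.

(* Hom(P, -) preserves exact sequences L -> M -> N. *)
Definition projective (P : superLmodType R) : Prop :=
  forall (L M N : superLmodType R) (f : smHom L M) (g : smHom M N),
    (forall y, g y = 0 <-> exists x, y = f x) ->
    forall h : smHom P M,
      (forall p, g (h p) = 0) <-> exists k : smHom P L, h = sm_comp f k.

Definition is_superAlg_iso (A B : superAlg R) (f : A -> B) : Prop :=
  [/\ zmod_morphism f, monoid_morphism f, even_map f,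
      (forall r, f (smap A r) = smap B r) & bijective f].

Definition super_azumaya (A : superAlg R) : Prop :=
  [/\ faithful (asmod A), finitely_generated (asmod A), projective (asmod A)
    & is_superAlg_iso (@phi R A)].
End Azumaya.

(* Main.v *)
(* A dual basis of the projective module A, applied to x = 1 * x, shows that
   A = T A, where T is the ideal of the values f(1) of the linear functionals f
   on A; Nakayama's lemma and faithfulness give an even R-linear g : A -> R with
   g(1) = 1.  If m supercommutes with A then s m = (phi(s)(1) (x) 1) m for every
   s in A^e, and if phi(s) = i o f for a functional f then s M is contained in
   M^A.  As phi is bijective, such an s exists for every right R-linear f.  Taking
   f = g shows that a (x) n |-> g(a) n is inverse to n |-> 1 (x) n on
   (A (x) N)^A, and taking for f the members f_j of a right dual basis
   x = sum_j e_j f_j(x), with phi(s_j) = i o f_j, shows that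
   m |-> sum_j e_j (x) s_j m is inverse to A (x) M^A -> M. *)
Require Import Defs.
From HB Require Import structures.
From mathcomp Require Import all_boot all_algebra.
From mathcomp Require Import boolp.

Set Implicit Arguments.
Unset Strict Implicit.
Unset Printing Implicit Defensive.

Import GRing.Theory.
Local Open Scope ring_scope.

(** * Graded modules and graded free modules *)

Section SuperModuleTheory.
Variable R : superRingType.

Lemma cptZ_homog (M : superLmodType R) i j (r : R) (x : M) : homog j x ->
  cpt i (r *: x) = cpt (i (+) j) r *: x.
Proof.
move=> hx; elim/homog_ind: r => [k r hr|r r' IH IH'].
  rewrite (cpt_homog _ (homogZ hr hx)) (cpt_homog _ hr).
  by case: i; case: j {hx}; case: k {hr}; rewrite /= ?scale0r.
by rewrite scalerDl !cptD IH IH' scalerDl.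
Qed.

Lemma cpt_sum_fun (V : gradedZmodType) (I : Type) (s : seq I) (F : I -> V) i :
  cpt i (\sum_(j <- s) F j) = \sum_(j <- s) cpt i (F j).
Proof. exact: (big_morph (cpt i) (cptD i) (cpt0 V i)). Qed.

(** A set-theoretic inverse suffices: linearity and parity pass to it through the injective [f]. *)
Lemma smHom_is_iso (M N : superLmodType R) (f : smHom M N) (g : N -> M) :
  cancel f g -> cancel g f -> is_iso (C := smod R) f.
Proof.
move=> fK gK.
have gL : linear g.
  by move=> r x y; apply: (can_inj fK); rewrite smfun_linear !gK.
have ge : even_map g.
  move=> i x hx; apply: (can_inj fK).
  by rewrite (even_cpt _ _ (smfunD f) (@smfun_even _ _ _ f)) gK.
by exists (SmHom gL ge); split; apply: smHom_eq.
Qed.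

End SuperModuleTheory.

(* The free module on generators indexed by I, the k-th one having parity p k. *)
Definition gfree (R : superRingType) (I : finType) (p : I -> bool) : Type :=
  {ffun I -> R^o}.

Section GradedFree.
Variables (R : superRingType) (I : finType) (p : I -> bool).
HB.instance Definition _ := GRing.Lmodule.copy (gfree R p) {ffun I -> R^o}.

Definition gfree_cpt (i : bool) (c : gfree R p) : gfree R p :=
  [ffun j => cpt (i (+) p j) (c j : R)].

Fact gfree_cptD i c d : gfree_cpt i (c + d) = gfree_cpt i c + gfree_cpt i d.
Proof. by apply/ffunP => j; rewrite !ffunE cptD. Qed.
Fact gfree_cpt_sum c : gfree_cpt false c + gfree_cpt true c = c.
Proof.
apply/ffunP => j; rewrite !ffunE.
by case: (p j); [rewrite addrC|]; apply: (cpt_sum (c j : R)).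
Qed.
Fact gfree_cptK i j c :
  gfree_cpt i (gfree_cpt j c) = if i == j then gfree_cpt j c else 0.
Proof.
apply/ffunP => k; rewrite !ffunE cptK (inj_eq (@addIb (p k))).
by case: ifP => _; rewrite ffunE.
Qed.
HB.instance Definition _ := isZ2Graded.Build (gfree R p)
  gfree_cptD gfree_cpt_sum gfree_cptK.

Lemma homog_gfree i (c : gfree R p) k : homog i c -> homog (i (+) p k) (c k : R).
Proof. by move=> hc; rewrite -{1}hc ffunE; apply: homog_cpt. Qed.

Fact gfree_homogZ i j (r : R) (c : gfree R p) :
  homog i r -> homog j c -> homog (i (+) j) (r *: c).
Proof.
move=> hr hc; apply/ffunP => k; rewrite !ffunE.
by rewrite -addbA; apply: (homogM hr (homog_gfree k hc)).
Qed.
HB.instance Definition _ := Lmodule_isSuper.Build R (gfree R p) gfree_homogZ.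

Variables (M : superLmodType R) (e : I -> M).
Hypothesis e_homog : forall k, homog (p k) (e k).

Definition gfree_comb (c : gfree R p) : M := \sum_k (c k : R) *: e k.

Fact gfree_comb_linear : linear gfree_comb.
Proof.
move=> r c d; rewrite /gfree_comb scaler_sumr -big_split.
by apply: eq_bigr => k _ /=; rewrite !ffunE scalerDl scalerA.
Qed.
Fact gfree_comb_even : even_map gfree_comb.
Proof.
move=> i c hc; rewrite /homog /gfree_comb cpt_sum_fun.
apply: eq_bigr => k _; have := homogZ (homog_gfree k hc) (e_homog k).
by rewrite -addbA addbb addbF.
Qed.
Definition gfree_hom : smHom (gfree R p) M := SmHom gfree_comb_linear gfree_comb_even.
End GradedFree.

(** * Homogeneous generators and dual bases *)

Lemma homog_generators (R : superRingType) (M : superLmodType R) :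
  finitely_generated M ->
  exists (I : finType) (p : I -> bool) (e : I -> M),
    (forall k, homog (p k) (e k)) /\
    (forall x, exists c : I -> R, x = \sum_k c k *: e k).
Proof.
(* Each generator is split into its two components, both taken with the original coefficient. *)
move=> [n [e span]]; exists ('I_n * bool)%type, snd, (fun k => cpt k.2 (e k.1)).
split=> [k|x]; first exact: homog_cpt.
have [c ->] := span x; exists (fun k => c k.1).
rewrite -(pair_bigA _ (fun k b => c k *: cpt b (e k))) /=.
apply: eq_bigr => k _; rewrite -scaler_sumr big_bool /= addrC.
by rewrite (cpt_sum (e k)).
Qed.

(** [projective] lifts parity-preserving maps only, so the surjection onto [M] starts from the free
    module whose generators have the parities [p]. The coordinates of a lift of the identity form
    the dual basis. *)
Lemma dual_basis (R : superRingType) (M : superLmodType R)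
    (I : finType) (p : I -> bool) (e : I -> M) :
  (forall k, homog (p k) (e k)) ->
  (forall x, exists c : I -> R, x = \sum_k c k *: e k) ->
  projective M ->
  exists h : I -> M -> R,
    [/\ forall k, {morph h k : x y / x + y},
        forall k r x, h k (r *: x) = r * h k x,
        forall k i x, homog i x -> homog (i (+) p k) (h k x)
      & forall x, \sum_k h k x *: e k = x].
Proof.
move=> e_homog span proj.
have zero_lin : linear (fun _ : M => 0 : M) by move=> r x y; rewrite scaler0 addr0.
have zero_even : even_map (fun _ : M => 0 : M) by move=> i x _; apply: homog0.
(* The zero endomorphism of [M] stands for the map to 0; exactness then says that the [e k]
   generate. *)
have exact_at_M (y : M) : SmHom zero_lin zero_even y = 0 <->
    exists c, y = gfree_hom e_homog c.
  split=> // _; have [c ->] := span y; exists [ffun k => c k].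
  by rewrite /= /gfree_comb; apply: eq_bigr => k _; rewrite ffunE.
have [+ _] := proj _ _ _ _ _ exact_at_M (sm_id M).
case=> // h hE; exists (fun k x => h x k); split=> [k x y|k r x|k i x hx|x].
- by rewrite smfunD ffunE.
- by rewrite smfunZ ffunE.
- exact: homog_gfree (smfun_even h hx).
- exact: esym (congr1 (fun f : smHom M M => f x) hE).
Qed.

(** * Nakayama's lemma over a supercommutative ring *)

Lemma supercommutative_even (R : superRingType) (u r : R) :
  supercommutative R -> homog false u -> u * r = r * u.
Proof.
move=> Rc hu; elim/homog_ind: r => [i r hr|r r' IH IH'].
  exact: Rc hu hr.
by rewrite mulrDl mulrDr IH IH'.
Qed.

(* Nakayama's lemma. Instead of taking a determinant, whose entries would be odd
   in part, the generators are eliminated one at a time: the multiplier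
   [1 - t] stays even, hence central. *)
Lemma nakayama (R : superRingType) (M : superLmodType R) (T : R -> Prop)
    (I : finType) (p : I -> bool) (e : I -> M) :
  supercommutative R -> faithful M ->
  (forall k, homog (p k) (e k)) ->
  (forall x, exists c : I -> R, x = \sum_k c k *: e k) ->
  T 0 -> (forall t t', T t -> T t' -> T (t + t')) ->
  (forall t r, T t -> T (t * r)) -> (forall t, T t -> T (cpt false t)) ->
  (forall x : M, exists (J : finType) (t : J -> R) (y : J -> M),
    (forall j, T (t j)) /\ x = \sum_j t j *: y j) ->
  T 1.
Proof.
move=> Rc faith e_homog span T0 TD TM Tcpt MT.
(* Invariant: [1 - t] maps [M] into the span of the generators left in [s]. For empty [s] it kills
   [M], and faithfulness gives [t = 1]. *)
have elim_gen (s : seq I) t : T t -> homog false t ->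
    (forall x, exists c : I -> R, (1 - t) *: x = \sum_(k <- s) c k *: e k) -> T 1.
  elim: s t => [|m s IH] t Tt ht red.
    suff -> : 1 = t by [].
    apply/eqP; rewrite -subr_eq0; apply/eqP/faith => x.
    by have [c ->] := red x; rewrite big_nil.
  have [c cE] := choice red.
  have [J [t' [y [Tt' emE]]]] := MT (e m).
  pose b k := \sum_j t' j * c (y j) k.
  have Tb k : T (b k).
    by apply: (big_ind T) => // j _; apply: TM.
  have hu : homog false (1 - t) by apply: homogD (homog1 R) (homogN ht).
  have uemE : (1 - t) *: e m = \sum_(k <- m :: s) b k *: e k.
    rewrite {1}emE scaler_sumr.
    rewrite (eq_bigr (fun j => \sum_(k <- m :: s) (t' j * c (y j) k) *: e k)).
      by rewrite exchange_big; apply: eq_bigr => k _; rewrite scaler_suml.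
    move=> j _; rewrite scalerA (supercommutative_even _ Rc hu) -scalerA cE.
    by rewrite scaler_sumr; apply: eq_bigr => k _; rewrite scalerA.
  (* Only the component of parity [p m] of the relation is kept, so the coefficient of [e m] itself
     becomes even, hence central. *)
  pose b' k := cpt (p m (+) p k) (b k).
  have {}uemE : (1 - t) *: e m = \sum_(k <- m :: s) b' k *: e k.
    have := homogZ hu (e_homog m); rewrite /= => <-.
    rewrite uemE cpt_sum_fun; apply: eq_bigr => k _.
    exact: cptZ_homog (e_homog k).
  pose t'' := b' m.
  have ht'' : homog false t'' by rewrite /t'' /b' addbb; apply: homog_cpt.
  have Tt'' : T t'' by rewrite /t'' /b' addbb; apply: Tcpt.
  have hv : homog false (1 - t - t'') by apply: homogD hu (homogN ht'').
  have vemE : (1 - t - t'') *: e m = \sum_(k <- s) b' k *: e k.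
    by rewrite scalerBl uemE big_cons addrC addKr.
  (* Chosen so that [1 - w] is [(1 - t - t'') * (1 - t)]: the first factor turns [e m] into a
     combination of the remaining generators. *)
  pose w := t + (t + t'') * (1 - t).
  have wE : 1 - w = (1 - t - t'') * (1 - t).
    by rewrite -addrA -opprD mulrBl mul1r /w opprD addrA.
  apply: (IH w).
  - by apply: (TD) => //; apply: TM; apply: TD.
  - by apply: homogD => //; apply: (homogM (homogD ht ht'') hu).
  move=> x; exists (fun k => c x m * b' k + (1 - t - t'') * c x k).
  rewrite wE -scalerA cE big_cons scalerDr scalerA (supercommutative_even _ Rc hv).
  rewrite -scalerA vemE !scaler_sumr -big_split.
  by apply: eq_bigr => k _; rewrite /= !scalerA scalerDl.
by apply: (elim_gen (index_enum I) 0) => //; apply: homog0.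
Qed.

Lemma cptMl (B : superRingType) i j (x y : B) : homog j x ->
  cpt i (x * y) = x * cpt (i (+) j) y.
Proof.
move=> hx; elim/homog_ind: y => [k y hy|y y' IH IH'].
  rewrite (cpt_homog _ (homogM hx hy)) (cpt_homog _ hy).
  by case: i; case: j {hx}; case: k {hy}; rewrite /= ?mulr0.
by rewrite mulrDr !cptD IH IH' mulrDr.
Qed.

(** * Left and right linear functionals on [A] *)

Section Functionals.
Variables (R : superRingType) (A : superAlg R).

Definition left_functional (f : A -> R) : Prop :=
  {morph f : x y / x + y} /\ (forall r x, f (smap A r * x) = r * f x).

Definition right_functional (f : A -> R) : Prop :=
  {morph f : x y / x + y} /\ (forall r x, f (x * smap A r) = f x * r).

(** This extracts the even component of [f]; since 1 is even, the value there keeps exactly its even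
    part. *)
Lemma left_functional_even_part (f : A -> R) : left_functional f ->
  exists g : A -> R, [/\ left_functional g, even_map g & g 1 = cpt false (f 1)].
Proof.
move=> [fD fZ]; have f0 := hom0 fD.
pose g x := \sum_(i : bool) cpt i (f (cpt i x)).
have gD : {morph g : x y / x + y}.
  by move=> x y; rewrite -big_split; apply: eq_bigr => i _ /=; rewrite cptD fD cptD.
have gE i x : homog i x -> g x = cpt i (f x).
  move=> hx; rewrite /g big_bool /= !(cpt_homog _ hx).
  by case: i {hx}; rewrite /= f0 cpt0 ?addr0 ?add0r.
exists g; split; last exact: gE (homog1 A).
  split=> // r x; elim/homog_ind: r => [l r hr|r r' IH IH']; last first.
    by rewrite rmorphD mulrDl gD IH IH' mulrDl.
  elim/homog_ind: x => [i x hx|x y IH IH']; last by rewrite mulrDr !gD IH IH' mulrDr.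
  rewrite (gE _ _ (homogM (smap_even hr) hx)) (gE _ _ hx) fZ (cptMl _ _ hr).
  by rewrite addbC addbA addbb.
by move=> i x hx; rewrite (gE _ _ hx); apply: homog_cpt.
Qed.

(* The right functional attached to a left functional of parity [p] is
   [x |-> (-1)^(p|x| + p) f x]; the constant sign [(-1)^p] makes left and right
   dual bases correspond. *)
Lemma left_functional_right (p : bool) (f : A -> R) (e : A) :
  supercommutative R -> left_functional f ->
  (forall i x, homog i x -> homog (i (+) p) (f x)) -> homog p e ->
  exists g : A -> R,
    right_functional g /\ (forall x, e * smap A (g x) = smap A (f x) * e).
Proof.
move=> Rc [fD fZ] hf he; have f0 := hom0 fD.
pose g x := \sum_(i : bool) sg (p && i (+) p) (f (cpt i x)).
have gD : {morph g : x y / x + y}.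
  by move=> x y; rewrite -big_split; apply: eq_bigr => i _ /=; rewrite cptD fD sgD.
have gE i x : homog i x -> g x = sg (p && i (+) p) (f x).
  move=> hx; rewrite /g big_bool /= !(cpt_homog _ hx).
  by case: i {hx}; rewrite /= f0 sg0 ?addr0 ?add0r.
exists g; split; first split=> //.
  move=> r x; elim/homog_ind: r => [l r hr|r r' IH IH']; last first.
    by rewrite rmorphD mulrDr gD IH IH' mulrDr.
  elim/homog_ind: x => [i x hx|x y IH IH']; last by rewrite mulrDl !gD IH IH' mulrDl.
  rewrite (gE _ _ (homogM hx (smap_even hr))) (gE _ _ hx) (smap_comm hr hx).
  rewrite (hom_sg _ _ fD) fZ sgMl (Rc _ _ _ _ (hf _ _ hx) hr) !sgC.
  by case: i {hx}; case: (p); case: l {hr}.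
elim/homog_ind => [i x hx|x y IH IH']; last first.
  by rewrite gD fD !rmorphD mulrDl mulrDr IH IH'.
rewrite (gE _ _ hx) (hom_sg _ _ (rmorphD (smap A))) sgMr.
(* Moving [e] past [f x] costs a sign of exponent [p(|x| + p)], which is [p|x| + p] modulo 2, the
   sign put into [g]. *)
rewrite (smap_comm (hf _ _ hx) he) sgC.
by case: i {hx}; case: (p).
Qed.

Hypotheses (Rc : supercommutative R) (Az : super_azumaya A).

Lemma azumaya_retraction : exists g : A -> R,
  [/\ left_functional g, right_functional g, even_map g & g 1 = 1].
Proof.
case: Az => faith fg proj _.
have [I [p [e [e_homog span]]]] := homog_generators fg.
have [h [hD hZ hh hE]] := dual_basis e_homog span proj.
pose T r := exists2 f : A -> R, left_functional f & f 1 = r.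
have [f fL f1] : T 1.
  apply: (nakayama (M := asmod A) Rc faith e_homog span).
  - by exists (fun=> 0) => //; split=> [x y|r x]; rewrite ?addr0 ?mulr0.
  - move=> _ _ [f [fD fZ] <-] [f' [fD' fZ'] <-]; exists (fun x => f x + f' x) => //.
    by split=> [x y|r x]; [rewrite fD fD' addrACA | rewrite fZ fZ' mulrDr].
  - move=> _ s [f [fD fZ] <-]; exists (fun x => f x * s) => //.
    by split=> [x y|r x]; [rewrite fD mulrDl | rewrite fZ mulrA].
  - move=> _ [f fL <-]; have [g [gL _ g1]] := left_functional_even_part fL.
    by exists g.
  move=> x; exists I, (fun k => h k 1), (fun k => (e k : A) * (x : A)); split.
    by move=> k; exists (h k) => //; split; [exact: hD | exact: hZ].
  rewrite -[LHS](mul1r (x : A)) -{1}(hE 1) mulr_suml.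
  by apply: eq_bigr => k _; rewrite !asmodZE mulrA.
have [g [[gD gZ] ge g1]] := left_functional_even_part fL.
exists g; split=> //; last by rewrite g1 f1; apply: homog1.
split=> // r x; elim/homog_ind: r => [l r hr|r r' IH IH']; last first.
  by rewrite rmorphD mulrDr gD IH IH' mulrDr.
elim/homog_ind: x => [i x hx|x y IH IH']; last by rewrite mulrDl !gD IH IH' mulrDl.
(* As [g] is even, exchanging [r] with [x] and with [g x] costs the same sign. *)
by rewrite (smap_comm hr hx) (hom_sg _ _ gD) gZ (Rc (ge _ _ hx) hr) andbC.
Qed.

(** Elements of [sEnd A] are right linear, so the coordinates must be right functionals to have
    preimages under [phi]; the left dual basis is converted one index at a time. *)
Lemma azumaya_right_dual_basis :
  exists (I : finType) (e : I -> A) (f : I -> A -> R),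
    (forall k, right_functional (f k)) /\
    (forall x, \sum_k e k * smap A (f k x) = x).
Proof.
case: Az => _ fg proj _.
have [I [p [e [e_homog span]]]] := homog_generators fg.
have [h [hD hZ hh hE]] := dual_basis e_homog span proj.
have hL k : left_functional (h k) by split; [exact: hD | exact: hZ].
have [f fP] := choice (fun k =>
  left_functional_right Rc (hL k) (hh k) (e_homog k : homog (p k) (e k : A))).
exists I, e, f; split=> [k|x]; first by have [] := fP k.
rewrite -[RHS]hE; apply: eq_bigr => k _.
by have [_ ->] := fP k.
Qed.
End Functionals.

(** * The action of [A^e] on supercommuting elements *)

Section EnvelopingAlgebra.
Variables (R : superRingType) (A : superAlg R).

Lemma spure1M (a b : A) : spure a 1 * spure b 1 = spure (a * b) 1 :> env A.
Proof.
elim/homog_ind: b => [i b hb|b b' IH IH'].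
  by rewrite (spureM _ _ (homog1 _) hb) mulr1.
by rewrite mulrDr !spureDl mulrDr IH IH'.
Qed.

Lemma spure1rM (a : A) (b : oppAlg A) : spure a 1 * spure 1 b = spure a b :> env A.
Proof. by rewrite (spureM _ _ (homog1 _) (homog1 _)) mulr1 mul1r. Qed.

Lemma phi_spure1 (a x : A) : phi (spure a 1) x = a * x.
Proof.
elim/homog_ind: x => [i x hx|x y IH IH']; last by rewrite sEndD IH IH' mulrDr.
by rewrite (phiE _ (homog1 _) hx) mulr1.
Qed.

Lemma phi_spure_unit (a b : A) : phi (spure a (b : oppAlg A)) 1 = a * b.
Proof.
elim/homog_ind: b => [i b hb|b b' IH IH'].
  by rewrite (phiE _ (hb : homog i (b : oppAlg A)) (homog1 _)) andbF mulr1.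
by rewrite spureDr phiD mulrDr -IH -IH'.
Qed.

(** Supercentrality of [i(r)] cancels the sign in [phi]: on the image of [R], signed right
    multiplication by [a] agrees with left multiplication. *)
Lemma phi_spure1r_smap (a : A) r : phi (spure 1 (a : oppAlg A)) (smap A r) = a * smap A r.
Proof.
elim/homog_ind: a => [i a ha|a a' IH IH']; last by rewrite spureDr phiD mulrDl -IH -IH'.
elim/homog_ind: r => [j r hr|r r' IH IH']; last by rewrite !rmorphD sEndD IH IH' mulrDr.
rewrite (phiE _ (ha : homog i (a : oppAlg A)) (smap_even hr)) mul1r.
by rewrite (smap_comm hr ha) andbC.
Qed.

Fact right_functional_end (f : A -> R) :
  right_functional f -> right_linear (fun x => smap A (f x)).
Proof. by move=> [fD fZ]; split=> [x y|x r]; rewrite ?fD ?fZ (rmorphD, rmorphM). Qed.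

Definition functional_end (f : A -> R) (fR : right_functional f) : sEnd A :=
  SEnd (right_functional_end fR).

Section Commutant.
Variable M : superLmodType (env A).
Implicit Types (m : M) (a : A) (s : env A).

(** A sign-free form of supercommutation, additive in [m] and meaningful for inhomogeneous [m]. *)
Definition env_commutes m : Prop :=
  forall a, (spure a 1 : env A) *: m = (spure 1 (a : oppAlg A) : env A) *: m.

Lemma env_commutesD m m' : env_commutes m -> env_commutes m' -> env_commutes (m + m').
Proof. by move=> mA mA' a; rewrite !scalerDr mA mA'. Qed.

Lemma env_commutes_cpt i m : env_commutes m -> env_commutes (cpt i m).
Proof.
move=> mA a; elim/homog_ind: a => [j a ha|a a' IH IH']; last first.
  by rewrite spureDl spureDr !scalerDl IH IH'.
have ha1 : homog j (spure a 1 : env A).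
  by rewrite -[j]addbF; apply: homog_spure ha (homog1 _).
have h1a : homog j (spure 1 (a : oppAlg A) : env A).
  exact: (homog_spure (homog1 _) (ha : homog j (a : oppAlg A))).
have := congr1 (cpt (i (+) j)) (mA a).
by rewrite (cptZ _ _ ha1) (cptZ _ _ h1a) addbK.
Qed.

(** For homogeneous [r], [i(r) (x) 1] is supercentral in [A^e], so it passes [a (x) 1] and [1 (x) a]
    with the same sign. *)
Lemma env_commutesZl r m : env_commutes m -> env_commutes (lact (smap A r) m).
Proof.
move=> mA a; elim/homog_ind: a => [j a ha|a a' IH IH']; last first.
  by rewrite spureDl spureDr !scalerDl IH IH'.
elim/homog_ind: r => [i r hr|r r' IH IH']; last first.
  by rewrite rmorphD lactDl !scalerDr IH IH'.
have ha1 : homog j (spure a 1 : env A).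
  by rewrite -[j]addbF; apply: homog_spure ha (homog1 _).
have h1a : homog j (spure 1 (a : oppAlg A) : env A).
  exact: (homog_spure (homog1 _) (ha : homog j (a : oppAlg A))).
rewrite /lact !scalerA (smap_comm (A := env A) hr ha1) (smap_comm (A := env A) hr h1a).
rewrite !(hom_sg _ _ (fun s t => scalerDl m s t)).
by rewrite -!scalerA mA.
Qed.

(** For homogeneous [r] and [m], [1 (x) i(r)] acts on [m] as [i(r) (x) 1], so the right action is
    the left one up to sign. *)
Lemma env_commutesZr r m : env_commutes m -> env_commutes (ract m (smap A r)).
Proof.
move=> mA; rewrite -[m]cpt_sum ractD.
suff homZr i : env_commutes (ract (cpt i m) (smap A r)) by apply: env_commutesD.
elim/homog_ind: r => [j r hr|r r' IH IH']; last first.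
  by rewrite rmorphD ractDr; apply: env_commutesD.
have mAi := env_commutes_cpt i mA.
rewrite (ractE (homog_cpt i m) (smap_even hr)) -mAi => a.
by rewrite !(hom_sg _ _ (scalerDr _)) (env_commutesZl r mAi).
Qed.

(** The condition survives every closure rule of [commutant]; conversely, the components of such an
    [m] are generators. *)
Lemma commutantP m : commutant m <-> env_commutes m.
Proof.
split=> [|mA].
  elim=> {m} [i m hm cm a|a|m m' _ IH _ IH'|r m _ IH|r m _ IH].
  - elim/homog_ind: a => [j a ha|a a' IH IH']; last first.
      by rewrite spureDl spureDr !scalerDl IH IH'.
    by have := cm j a ha; rewrite (ractE hm ha) sgC andbC addbb.
  - by rewrite !scaler0.
  - exact: env_commutesD.
  - exact: env_commutesZl.
  - exact: env_commutesZr.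
have gen i : commutant (cpt i m).
  apply: (commutant_gen (homog_cpt i m)) => j a ha.
  by rewrite (ractE (homog_cpt i m) ha) sgC andbC addbb; apply: env_commutes_cpt.
by rewrite -[m]cpt_sum; apply: commutantD.
Qed.

(** Write [a (x) b = (a (x) 1)(1 (x) b)] and replace [1 (x) b] by [b (x) 1] on [m]; the resulting
    [ab] is [phi(a (x) b)(1)], without sign because 1 is even. *)
Lemma commutant_scale m s : commutant m -> s *: m = lact (phi s 1) m.
Proof.
move=> /commutantP mA; elim/stens_ind: s => [i j a b _ _|s t IH IH'].
  by rewrite -spure1rM -scalerA -mA scalerA spure1M spure1rM phi_spure_unit.
by rewrite scalerDl phiD [RHS]lactDl IH IH'.
Qed.

(** This makes the map from [A (x) M^A] to [M] linear over [A^e]. *)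
Lemma commutant_scale_lact m s x : commutant m -> s *: lact x m = lact (phi s x) m.
Proof.
move=> mA; rewrite {1}/lact scalerA (commutant_scale _ mA) rmorphM.
by congr lact; rewrite -[LHS]/(phi s (phi (spure x 1) 1)) phi_spure1 mulr1.
Qed.

End Commutant.
End EnvelopingAlgebra.

(** * The isomorphism between [(A (x) N)^A] and [N] *)

Section Retraction.
Variables (R : superRingType) (A : superAlg R) (g : A -> R).
Hypotheses (gL : left_functional g) (gR : right_functional g) (g_even : even_map g).
Variable N : superLmodType R.

Definition tens_eval : tens A N -> N := tlift (fun a n => g a *: n).

Fact tens_eval_bal : balanced (fun (a : A) (n : N) => g a *: n).
Proof.
case: gR => gD gZ; split=> [n a b|a m n|a r n].
- by rewrite gD scalerDl.
- by rewrite scalerDr.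
- by rewrite gZ scalerA.
Qed.

Lemma tens_evalE a n : tens_eval (pure a n) = g a *: n.
Proof. exact: (tliftE tens_eval_bal). Qed.

Lemma tens_evalD : {morph tens_eval : s t / s + t}.
Proof. exact: (tliftD tens_eval_bal). Qed.

Definition scomm_eval (x : scomm (tens A N)) : N := tens_eval (scomm_val x).

Fact scomm_eval_linear : linear scomm_eval.
Proof.
move=> r x y; rewrite /scomm_eval tens_evalD; congr (_ + _).
(* The identity holds on all of [A (x) N], so the induction may leave the supercommutant. *)
rewrite /= /lact; elim/tens_ind0: (scomm_val x) => [a n|s t IH IH'].
  by rewrite tens_scaleE !tens_evalE phi_spure1 (gL.2 r a) scalerA.
by rewrite scalerDr !tens_evalD IH IH' scalerDr.
Qed.

Fact scomm_eval_even : even_map scomm_eval.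
Proof.
move=> i x /homog_scomm; rewrite /scomm_eval.
elim/homog_tens_ind => [j a n ha hn|s t IH IH']; last by rewrite tens_evalD; apply: homogD.
rewrite tens_evalE; have := homogZ (g_even ha) hn.
by rewrite addbA addbb.
Qed.

Definition scomm_eval_hom : smHom (scomm (tens A N)) N :=
  SmHom scomm_eval_linear scomm_eval_even.

(** Both [a (x) 1] and [1 (x) a] send [1 (x) n] to [a (x) n]. *)
Lemma env_commutes_pure1 n : env_commutes (pure 1 n : tens A N).
Proof.
move=> a; rewrite !tens_scaleE phi_spure1.
by have := phi_spure1r_smap a 1; rewrite rmorph1 => ->.
Qed.

Definition scomm_pure1 (n : N) : scomm (tens A N) :=
  SComm (asboolT ((commutantP _).2 (env_commutes_pure1 n))).

Hypotheses (g1 : g 1 = 1) (phi_bij : bijective (@phi R A)).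

(** If [phi(s) = i o g], then [s (a (x) n) = 1 (x) g(a) n] by moving the scalar across the tensor
    sign, while on the supercommutant [s] acts as [i(g(1)) = 1]. *)
Lemma scomm_evalK : cancel scomm_eval scomm_pure1.
Proof.
move=> x; apply: scomm_eq => /=.
have [psi _ phiK] := phi_bij; pose s := psi (functional_end gR).
have -> : pure 1 (scomm_eval x) = s *: scomm_val x.
  rewrite /scomm_eval; elim/tens_ind0: (scomm_val x) => [a n|t u IH IH'].
    by rewrite tens_evalE tens_scaleE phiK -pure_bal mul1r.
  by rewrite tens_evalD pureDr IH IH' scalerDr.
rewrite (commutant_scale _ (scomm_in x)) phiK /= g1 rmorph1.
exact: scale1r.
Qed.

Lemma scomm_pure1K : cancel scomm_pure1 scomm_eval.
Proof. by move=> n; rewrite /scomm_eval tens_evalE g1 scale1r. Qed.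
End Retraction.

(** * The isomorphism between [A (x) M^A] and [M] *)

Section Counit.
Variables (R : superRingType) (A : superAlg R) (M : superLmodType (env A)).

Definition tens_act : tens A (scomm M) -> M :=
  tlift (A := A) (N := scomm M) (fun a m => lact a (scomm_val m)).

Fact tens_act_bal : balanced (A := A) (N := scomm M) (fun a m => lact a (scomm_val m)).
Proof.
split=> [m a b|a m n|a r m].
- exact: lactDl.
- exact: lactD.
- by rewrite /= /lact scalerA spure1M.
Qed.

Lemma tens_actE a (m : scomm M) : tens_act (pure a m) = lact a (scomm_val m).
Proof. exact: (tliftE tens_act_bal). Qed.

Lemma tens_actD : {morph tens_act : s t / s + t}.
Proof. exact: (tliftD tens_act_bal). Qed.

Fact tens_act_linear : linear tens_act.
Proof.
move=> s t u; rewrite tens_actD; congr (_ + _).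
elim/tens_ind0: t => [a m|t t' IH IH'].
  by rewrite tens_scaleE !tens_actE (commutant_scale_lact _ _ (scomm_in m)).
by rewrite scalerDr !tens_actD IH IH' scalerDr.
Qed.

Fact tens_act_even : even_map tens_act.
Proof.
move=> i t; elim/homog_tens_ind => [j a m ha /homog_scomm hm|s u IH IH'].
  by rewrite tens_actE; have := homog_lact ha hm; rewrite addbA addbb.
by rewrite tens_actD; apply: homogD.
Qed.

Definition tens_act_hom : smHom (tens A (scomm M)) M :=
  SmHom tens_act_linear tens_act_even.

Hypothesis phi_bij : bijective (@phi R A).

(** [phi s] takes values in [i(R)], where left and signed right multiplication by [a] agree;
    injectivity of [phi] then gives [(a (x) 1) s = (1 (x) a) s]. *)
Lemma env_commutes_functional (f : A -> R) (fR : right_functional f) (s : env A) (m : M) :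
  phi s = functional_end fR -> env_commutes (s *: m).
Proof.
move=> phis a; rewrite !scalerA; congr (_ *: _); apply: (bij_inj phi_bij).
apply: sEnd_eq => x; rewrite !rmorphM.
rewrite -[LHS]/(phi (spure a 1) (phi s x)) -[RHS]/(phi (spure 1 _) (phi s x)) phis.
by rewrite phi_spure1 phi_spure1r_smap.
Qed.

Lemma tens_act_bij (I : finType) (e : I -> A) (f : I -> A -> R) :
  (forall k, right_functional (f k)) ->
  (forall x, \sum_k e k * smap A (f k x) = x) ->
  exists act' : M -> tens A (scomm M), cancel tens_act act' /\ cancel act' tens_act.
Proof.
move=> fR fE; have [psi psiK phiK] := phi_bij.
pose s k := psi (functional_end (fR k)).
have sM k (m : M) : commutant (s k *: m).
  exact/commutantP/(env_commutes_functional _ (phiK _)).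
pose act' m : tens A (scomm M) := \sum_k pure (e k) (SComm (asboolT (sM k m))).
have act'D : {morph act' : m n / m + n}.
  move=> m n; rewrite -big_split; apply: eq_bigr => k _ /=.
  by rewrite -pureDr; congr pure; apply: scomm_eq; rewrite /= scalerDr.
exists act'; split=> [t|m].
  elim/tens_ind0: t => [x m|t u IH IH']; last by rewrite tens_actD act'D IH IH'.
  rewrite tens_actE -[x in RHS]fE /act'.
  rewrite (big_morph (fun y => pure y m) (fun y z => pureDl y z m) (pure0l _ m)).
  (* The scalar [f_k(x)] crosses the tensor sign, and [f_k(x) m = s_k (x m)] because [m]
     supercommutes. *)
  apply: eq_bigr => k _; rewrite pure_bal; congr pure; apply: scomm_eq => /=.
  by rewrite (commutant_scale_lact _ _ (scomm_in m)) phiK.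
rewrite (big_morph _ tens_actD (hom0 tens_actD)).
under eq_bigr => k _ do rewrite tens_actE /lact scalerA.
rewrite -scaler_suml.
suff -> : \sum_k (spure (e k) 1 : env A) * s k = 1 by rewrite scale1r.
(* [phi] turns this sum into [x |-> sum_k e_k i(f_k(x))], which is the identity by the dual basis
   relation. *)
apply: (bij_inj phi_bij); rewrite rmorph1 rmorph_sum; apply: sEnd_eq => x.
rewrite -[RHS]fE.
rewrite (big_morph (fun h : sEnd A => h x) (id1 := 0) (op1 := +%R)) //.
apply: eq_bigr => k _; rewrite rmorphM.
by rewrite -[LHS]/(phi (spure (e k) 1) (phi (s k) x)) phiK phi_spure1.
Qed.
End Counit.

Theorem theorem4p3p1 (R : superRingType) (A : superAlg R)
    (R_supercomm : supercommutative R) (A_azumaya : super_azumaya A) :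
  mutually_inverse_equivalences (tensor_functor A) (commutant_functor A).
Proof.
have phi_bij : bijective (@phi R A) by case: A_azumaya => _ _ _ [].
split.
  have [g [gL gR g_even g1]] := azumaya_retraction R_supercomm A_azumaya.
  (* One [g] serves every [N], so naturality reduces to the linearity of the given morphism. *)
  exists (fun N => scomm_eval_hom gL gR g_even N); split=> [M N f|N].
    apply: smHom_eq => x /=; rewrite /scomm_eval /=.
    elim/tens_ind0: (scomm_val x) => [a m|s t IH IH'].
      by rewrite tens_mapE !(tens_evalE gR) smfunZ.
    by rewrite tens_mapD !(tens_evalD gR) smfunD IH IH'.
  apply: (smHom_is_iso (g := @scomm_pure1 R A N)).
    exact: (scomm_evalK gR g1 phi_bij).
  exact: (scomm_pure1K gR g1).
have [I [e [f [fR fE]]]] := azumaya_right_dual_basis R_supercomm A_azumaya.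
(* The chosen dual basis enters only the inverse, so naturality is independent of it. *)
exists (fun M => tens_act_hom M); split=> [M N h|M].
  apply: smHom_eq => t /=; elim/tens_ind0: t => [a m|s t IH IH'].
    by rewrite tens_mapE !tens_actE smfun_lact.
  by rewrite tens_mapD !tens_actD IH IH' smfunD.
have [act' [actK act'K]] := tens_act_bij M phi_bij fR fE.
exact: (smHom_is_iso (f := tens_act_hom M) actK act'K).
Qed.
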